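(* For every integer $s\ge4$, the quotient $\mathcal M(-s)/\mathcal S(s)$ is a realization of the quotient $\Omega^1(-1^s)/PSL(2,\mathbb C)$; that is, $\Omega^1(-1^s)/PSL(2,\mathbb C)$ is homeomorphic to $\mathcal M(-s)/\mathcal S(s)$, where $\mathcal S(s)$ acts on $\mathcal M(-s)$ by the action described in the context.
   Context: $\Omega^1(-1^s)$ denotes the set of rational 1-forms on the Riemann sphere $\widehat{\mathbb C}$ having exactly $s$ poles, all simple (zeros are arbitrary). It is a $(2s-1)$-dimensional complex manifold via the bijection sending $\omega$ to the class $\langle r_1,\dots,r_s;p_1,\dots,p_s\rangle$ of its residues $r_\iota$ at its poles $p_\iota$ in $\bigl(H_s\times(\widehat{\mathbb C}^s\setminus\Delta)\bigr)/\mathcal S(s)$, where $H_s=\{(r_1,\dots,r_s)\in(\mathbb C^* )^s : \sum r_\iota=0\}$, $\widehat{\mathbb C}^s\setminus\Delta$ is the set of $s$-tuples of pairwise distinct points of $\widehat{\mathbb C}$, and the symmetric group $\mathcal S(s)$ permutes the $r_\iota$ and the $p_\iota$ simultaneously. $PSL(2,\mathbb C)$ acts by push-forward, $T_*\langle r_1,\dots,r_s;p_1,\dots,p_s\rangle=\langle r_1,\dots,r_s;T(p_1),\dots,T(p_s)\rangle$. Quotients carry the quotient topology. Let $\mathbb A_s=\{(r_1,\dots,r_{s-1})\in\mathbb C^{s-1}: r_1+\dots+r_{s-1}\neq0,\ r_\iota\ne0 \text{ for } \iota=1,\dots,s-1\}$, let $[\mathbb C^*\setminus\{1\}]^{s-3}\setminus\Delta=\{(p_4,\dots,p_s)\in[\mathbb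 C^*\setminus\{1\}]^{s-3}: p_\iota\neq p_\kappa\text{ for }\iota\ne\kappa\}$, and $$\mathcal M(-s)=\mathbb A_s\times\bigl([\mathbb C^*\setminus\{1\}]^{s-3}\setminus\Delta\bigr).$$ A point $(r_1,\dots,r_{s-1},p_4,\dots,p_s)$ of $\mathcal M(-s)$ represents the 1-form $\langle r_1,\dots,r_s;0,\infty,1,p_4,\dots,p_s\rangle$ with $r_s=-(r_1+\dots+r_{s-1})$. The action of $\mathcal S(s)$ on $\mathcal M(-s)$ is $\sigma\cdot(r_1,\dots,r_{s-1},p_4,\dots,p_s)=\bigl(A_\sigma(r_1,\dots,r_{s-1})^{T},\,f_\sigma(p_4,\dots,p_s)\bigr)$, where $\sigma\mapsto(A_\sigma,f_\sigma)\in GL_{s-1}(\mathbb Z)\times Bir(\widehat{\mathbb C}^{s-3})$ is the representation (with $Bir$ the group of birational maps) determined on the Coxeter generators $\sigma_j=(j\ \ j+1)$, $j=1,\dots,s-1$, by $(A_j,f_j)$ with: for $j=1,\dots,s-2$, $A_j$ is the identity matrix with rows $j$ and $j+1$ exchanged; $A_{s-1}$ is the identity matrix with row $s-1$ replaced by $(-1,\dots,-1)$; and $$f_1=\Bigl(\tfrac1{z_4},\dots,\tfrac1{z_s}\Bigr),\quad f_2=\Bigl(\tfrac{z_4}{z_4-1},\dots,\tfrac{z_s}{z_s-1}\Bigr),\quad f_3=\Bigl(\tfrac1{z_4},\tfrac{z_5}{z_4},\dots,\tfrac{z_s}{z_4}\Bigr),$$ $$f_j=(z_{\sigma_j(4)},\dots,z_{\sigma_j(s)})\quad\text{for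 } j=4,\dots,s-1.$$ *)

(* Defs.v *)
From HB Require Import structures.
From Stdlib Require Import Relation_Operators.
From mathcomp Require Import all_boot all_order all_algebra all_fingroup.
From mathcomp Require Import all_classical all_reals all_analysis.
From mathcomp Require Import complex ring.
From mathcomp Require mpoly.

Set Implicit Arguments.
Unset Strict Implicit.
Unset Printing Implicit Defensive.

Import Order.TTheory GRing.Theory Num.Theory.
Import numFieldNormedType.Exports.

Local Open Scope classical_set_scope.
Local Open Scope complex_scope.
Local Open Scope ring_scope.

Definition homeomorphic (X Y : topologicalType) : Prop :=
  exists (f : X -> Y) (g : Y -> X),
    [/\ cancel f g, cancel g f, continuous f & continuous g].

Section Quotient.
Variables (T : topologicalType) (E : T -> T -> Prop).

Definition gen_rel : rel T := fun x y => `[< clos_refl_sym_trans T E x y >].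

Lemma gen_rel_refl : reflexive gen_rel.
Proof. by move=> x; apply/asboolP; exact: rst_refl. Qed.

Lemma gen_rel_sym : symmetric gen_rel.
Proof. by move=> x y; apply/asboolP/asboolP; exact: rst_sym. Qed.

Lemma gen_rel_trans : transitive gen_rel.
Proof.
by move=> y x z /asboolP xy /asboolP yz; apply/asboolP; exact: rst_trans xy yz.
Qed.

Canonical gen_equiv := EquivRel gen_rel gen_rel_refl gen_rel_sym gen_rel_trans.

(* The quotient of T by the equivalence relation generated by E, with the
   quotient topology.  When "E x y" means that y = g x for some g in a group
   acting on T, this is the orbit space: E is already an equivalence. *)
Definition quotient_space : topologicalType :=
  quotient_topology {eq_quot gen_equiv}%qT.

Definition quotient_map (x : T) : quotient_space :=
  (\pi_(quotient_topology {eq_quot gen_equiv}) x)%qT.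

End Quotient.

(* Rational 1-forms on the projective line over a field F. *)
Section RationalForms.
Variable F : fieldType.
Local Notation K := {fraction {poly F}}.
Local Notation "x %:F" := (@FracField.tofrac {poly F} x).

Definition numer (h : K) : {poly F} := (frac (generic_quotient.repr h)).1.
Definition denom (h : K) : {poly F} := (frac (generic_quotient.repr h)).2.

Definition const (c : F) : K := c%:P%:F.

Definition eval_at (p : {poly F}) (phi : K) : K := (map_poly const p).[phi].

(* The composite h o phi; phi is meant to be nonconstant, so that the
   denominator does not vanish. *)
Definition rat_comp (h phi : K) : K :=
  eval_at (numer h) phi / eval_at (denom h) phi.

Definition rat_deriv (h : K) : K :=
  ((numer h)^`() * denom h - numer h * (denom h)^`())%:F / (denom h ^+ 2)%:F.

(* The 1-form h(z) dz is represented by h : K.  Its pull-back by a rational map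
   phi is (h o phi) phi' dz. *)
Definition pullback (phi h : K) : K := rat_comp h phi * rat_deriv phi.

(* Points of the projective line are elements of "option F", None being the
   point at infinity.  "chart q" expresses z through the coordinate w centred
   at q: z = w + a if q = a is finite, and z = 1/w if q is infinity. *)
Definition chart (q : option F) : K :=
  if q is Some a then ('X + a%:P)%:F else ('X%:F)^-1.

(* "germ h q" dw is the 1-form h dz in the coordinate w centred at q. *)
Definition germ (h : K) (q : option F) : K := pullback (chart q) h.

(* g is regular at 0, with value v *)
Definition value0 (g : K) (v : F) : Prop :=
  exists P Q : {poly F}, [/\ Q.[0] != 0, g = P%:F / Q%:F & v = P.[0] / Q.[0]].

Definition is_pole (h : K) (q : option F) : Prop :=
  ~ exists v, value0 (germ h q) v.

(* h dz has at q at most a simple pole, with residue r. *)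
Definition simple_residue (h : K) (q : option F) (r : F) : Prop :=
  value0 ('X%:F * germ h q) r.

Definition simple_pole (h : K) (q : option F) : Prop :=
  is_pole h q /\ exists r, simple_residue h q r.

(* z |-> (a z + b) / (c z + d) for M = (a b; c d) *)
Definition moebius (M : 'M[F]_2) : K :=
  (M 0 0 *: 'X + (M 0 1)%:P)%:F / (M 1 0 *: 'X + (M 1 1)%:P)%:F.

(* The push-forward of h dz by the Moebius transformation of M, i.e. its
   pull-back by the inverse transformation. *)
Definition pushforward (M : 'M[F]_2) (h : K) : K :=
  pullback (moebius (invmx M)) h.

(* The lemmas up to "residue_sum0" (the sum of the residues is 0) are what is
   needed to know that the residues of a 1-form with simple poles lie in the
   set H below. *)
Lemma denom_neq0 (h : K) : denom h != 0.
Proof. exact: denom_ratioP. Qed.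

Lemma fracE (h : K) : h = (numer h)%:F / (denom h)%:F.
Proof.
rewrite /numer /denom; set x := generic_quotient.repr h.
have -> : h = \pi_({fraction {poly F}})%qT x by rewrite generic_quotient.reprK.
move: x => x.
have d0 : (frac x).2 != 0 by exact: denom_ratioP.
apply: (@mulIf _ ((frac x).2)%:F); first by rewrite tofrac_eq0.
rewrite divfK ?tofrac_eq0//.
rewrite -[_ * _]/(FracField.mul _ _) !generic_quotient.piE.
apply/generic_quotient.eqmodP; rewrite /= FracField.equivfE /FracField.mulf.
by rewrite !numden_Ratio ?mulf_neq0 ?oner_eq0 ?mulr1 1?mulrC.
Qed.

Lemma const_zmod : zmod_morphism const.
Proof. by move=> a b; rewrite /const polyCB rmorphB. Qed.
Lemma const_monoid : monoid_morphism const.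
Proof. by split=> [|a b]; rewrite /const ?polyCM ?rmorphM ?polyC1 ?rmorph1. Qed.
HB.instance Definition _ := GRing.isZmodMorphism.Build F K const const_zmod.
HB.instance Definition _ := GRing.isMonoidMorphism.Build F K const const_monoid.

Lemma eval_atM p q phi : eval_at (p * q) phi = eval_at p phi * eval_at q phi.
Proof. by rewrite /eval_at rmorphM hornerM. Qed.

Lemma eval_atD p q phi : eval_at (p + q) phi = eval_at p phi + eval_at q phi.
Proof. by rewrite /eval_at rmorphD hornerD. Qed.

Lemma eval_atC c phi : eval_at c%:P phi = const c.
Proof. by rewrite /eval_at map_polyC hornerC. Qed.

Lemma eval_atX phi : eval_at 'X phi = phi.
Proof. by rewrite /eval_at map_polyX hornerX. Qed.

Lemma eval_at_comp (p q : {poly F}) : eval_at p q%:F = (p \Po q)%:F.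
Proof.
elim/poly_ind: p => [|p c IH].
  by rewrite comp_poly0 eval_atC /const polyC0.
rewrite eval_atD eval_atM eval_atX eval_atC IH comp_poly_MXaddC.
by rewrite rmorphD rmorphM.
Qed.

Definition nonconst (phi : K) := forall c : F, phi != const c.

Lemma nonconst_chart (q : option F) : nonconst (chart q).
Proof.
case: q => [a|] c; rewrite /chart.
  rewrite tofrac_eq; apply/eqP => /(congr1 (fun p : {poly F} => p`_1)).
  by rewrite coefD !coefC coefX addr0 => /eqP; rewrite oner_eq0.
apply/eqP => /(congr1 (fun x => x * 'X%:F)).
rewrite mulVf ?tofrac_eq0 ?polyX_eq0// /const -rmorphM.
rewrite -[LHS](rmorph1 (@FracField.tofrac {poly F})).
move/eqP; rewrite tofrac_eq => /eqP /(congr1 (fun p : {poly F} => p.[0])).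
by rewrite !hornerE ?mulr0 => /eqP; rewrite ?oner_eq0.
Qed.

Section Closed.
(* A hypothesis, because R[i]^o has no closedFieldType instance. *)
Hypothesis Fclosed : forall p : {poly F}, size p != 1%N -> exists x, root p x.

Lemma eval_at_neq0 (p : {poly F}) phi : nonconst phi -> p != 0 ->
  eval_at p phi != 0.
Proof.
move=> nc; have [n] := ubnP (size p); elim: n p => // n IH p sp p0.
have [/size_poly1P[c c0 ->]|/Fclosed[a /factor_theorem[q pq]]] :=
    boolP (size p == 1%N).
  by rewrite eval_atC fmorph_eq0.
have q0 : q != 0 by apply: contra_neq p0 => q0; rewrite pq q0 mul0r.
rewrite pq eval_atM; apply: mulf_neq0.
  apply: IH (q0); move: sp; rewrite pq.
  by rewrite (size_Mmonic q0 (monicXsubC a)) size_XsubC addn2 ltnS.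
by rewrite -polyCN eval_atD eval_atX eval_atC rmorphN subr_eq0.
Qed.

Lemma rat_compE (p q : {poly F}) phi : nonconst phi -> q != 0 ->
  rat_comp (p%:F / q%:F) phi = eval_at p phi / eval_at q phi.
Proof.
move=> nc q0; rewrite /rat_comp.
set h := p%:F / q%:F; have := fracE h; have := denom_neq0 h.
move: (numer h) (denom h) => n d d0 /eqP.
rewrite eqr_div ?tofrac_eq0// -!rmorphM tofrac_eq => /eqP pd.
by apply/eqP; rewrite eqr_div ?eval_at_neq0// -!eval_atM pd.
Qed.

Lemma rat_compP (p : {poly F}) phi : nonconst phi ->
  rat_comp p%:F phi = eval_at p phi.
Proof.
move=> nc; rewrite -[p%:F]divr1 -(rmorph1 (@FracField.tofrac {poly F})).
by rewrite rat_compE ?oner_neq0// (eval_atC 1) rmorph1 divr1.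
Qed.

Lemma rat_compD (g h : K) phi : nonconst phi ->
  rat_comp (g + h) phi = rat_comp g phi + rat_comp h phi.
Proof.
move=> nc; rewrite (fracE g) (fracE h) addf_div ?tofrac_eq0 ?denom_neq0//.
rewrite -!rmorphM -rmorphD !rat_compE ?mulf_neq0 ?denom_neq0//.
by rewrite eval_atD !eval_atM addf_div ?eval_at_neq0 ?denom_neq0.
Qed.

Lemma rat_comp0 phi : nonconst phi -> rat_comp 0 phi = 0.
Proof.
move=> nc; rewrite -(rmorph0 (@FracField.tofrac {poly F})) rat_compP//.
by rewrite eval_atC rmorph0.
Qed.

Lemma rat_compN g phi : nonconst phi -> rat_comp (- g) phi = - rat_comp g phi.
Proof.
move=> nc; apply: (addrI (rat_comp g phi)).
by rewrite -rat_compD// !subrr rat_comp0.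
Qed.

Lemma rat_comp_sum (I : finType) (G : I -> K) phi : nonconst phi ->
  rat_comp (\sum_i G i) phi = \sum_i rat_comp (G i) phi.
Proof.
move=> nc; elim/big_ind2 : _ => [|x1 x2 y1 y2 <- <-|//]; first exact: rat_comp0.
exact: rat_compD.
Qed.

End Closed.

Lemma rat_derivE (p q : {poly F}) : q != 0 ->
  rat_deriv (p%:F / q%:F) = (p^`() * q - p * q^`())%:F / (q ^+ 2)%:F.
Proof.
move=> q0; rewrite /rat_deriv.
set h := p%:F / q%:F; have := fracE h; have := denom_neq0 h.
move: (numer h) (denom h) => n d d0 /eqP.
rewrite eqr_div ?tofrac_eq0// -!rmorphM tofrac_eq => /eqP pd.
apply/eqP; rewrite eqr_div ?tofrac_eq0 ?expf_neq0// -!rmorphM tofrac_eq.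
have pd' : p^`() * d + p * d^`() = n^`() * q + n * q^`() by rewrite -!derivM pd.
apply/eqP.
transitivity (q * d * (n^`() * q + n * q^`()) -
              (n * q) * (d * q^`() + q * d^`())).
  by ring.
by rewrite -pd -pd'; ring.
Qed.

Lemma value0_poly (p : {poly F}) : value0 p%:F p.[0].
Proof.
by exists p, 1; split; rewrite ?hornerC ?oner_neq0// ?divr1.
Qed.

Lemma value0D g h u v : value0 g u -> value0 h v -> value0 (g + h : K) (u + v).
Proof.
move=> [P1 [Q1 [Q10 -> ->]]] [P2 [Q2 [Q20 -> ->]]].
have nz (Q : {poly F}) : Q.[0] != 0 -> Q%:F != 0.
  by rewrite tofrac_eq0; apply: contra_neq => ->; rewrite horner0.
exists (P1 * Q2 + P2 * Q1), (Q1 * Q2); split.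
- by rewrite hornerM mulf_neq0.
- by rewrite addf_div ?nz// -!rmorphM -rmorphD.
- by rewrite addf_div// !hornerE.
Qed.

Lemma value0M g h u v : value0 g u -> value0 h v -> value0 (g * h : K) (u * v).
Proof.
move=> [P1 [Q1 [Q10 -> ->]]] [P2 [Q2 [Q20 -> ->]]].
exists (P1 * P2), (Q1 * Q2); split; first by rewrite hornerM mulf_neq0.
  by rewrite mulf_div -!rmorphM.
by rewrite mulf_div !hornerE.
Qed.

Lemma value0N g u : value0 g u -> value0 (- g : K) (- u).
Proof.
move=> gu; rewrite -mulN1r -[- u]mulN1r; apply: value0M gu.
have := value0_poly (-1)%:P; rewrite hornerC polyCN rmorphN rmorph1.
exact.
Qed.

Lemma value0_sum (I : finType) (G : I -> K) (u : I -> F) :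
  (forall i, value0 (G i) (u i)) -> value0 (\sum_i G i) (\sum_i u i).
Proof.
move=> Gu; elim/big_ind2 : _ => [|x1 x2 y1 y2 a b|//]; last exact: value0D.
by have := value0_poly 0; rewrite horner0 rmorph0.
Qed.

Lemma regular_sum (I : finType) (P : pred I) (G : I -> K) :
  (forall i, P i -> exists v, value0 (G i) v) ->
  exists v, value0 (\sum_(i | P i) G i) v.
Proof.
move=> Gv; elim/big_ind : _ => [|x y [u xu] [v yv]|//].
  by exists 0; have := value0_poly 0; rewrite horner0 rmorph0.
by exists (u + v); exact: value0D.
Qed.

Lemma value0V (p : {poly F}) : p.[0] != 0 -> value0 (p%:F)^-1 (p.[0])^-1.
Proof.
by move=> p0; exists 1, p; split; rewrite ?hornerC ?div1r.
Qed.

Lemma value0_uniq g u v : value0 (g : K) u -> value0 g v -> u = v.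
Proof.
move=> [P1 [Q1 [Q10 -> ->]]] [P2 [Q2 [Q20 + ->]]].
have nz (Q : {poly F}) : Q.[0] != 0 -> Q%:F != 0.
  by rewrite tofrac_eq0; apply: contra_neq => ->; rewrite horner0.
move=> /eqP; rewrite eqr_div ?nz// -!rmorphM tofrac_eq => /eqP.
move=> /(congr1 (fun p : {poly F} => p.[0])); rewrite !hornerM => E.
by apply/eqP; rewrite eqr_div// E.
Qed.

Lemma value0_div_eq0 (P Q : {poly F}) v :
  Q != 0 -> value0 (P%:F / Q%:F) v -> Q.[0] = 0 -> P.[0] = 0.
Proof.
move=> Q0 [A [B [B0 + _]]] Qr.
have B00 : B != 0 by apply: contra_neq B0 => ->; rewrite horner0.
move=> /eqP; rewrite eqr_div ?tofrac_eq0// -!rmorphM tofrac_eq => /eqP.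
move=> /(congr1 (fun p : {poly F} => p.[0])); rewrite !hornerM Qr mulr0.
by move=> /eqP; rewrite mulf_eq0 (negbTE B0) orbF => /eqP.
Qed.

Lemma X_neq0 : 'X%:F != 0 :> K.
Proof. by rewrite tofrac_eq0 polyX_eq0. Qed.

Lemma regular_sub_polar g r :
  value0 ('X%:F * g) r -> exists v, value0 (g - const r / 'X%:F) v.
Proof.
move=> [P [Q [Q0 gE rE]]].
have [N PN] : exists N, P - r%:P * Q = N * ('X - 0%:P).
  by apply/factor_theorem; rewrite /root !hornerE rE divfK ?subrr.
exists (N.[0] / Q.[0]), N, Q; split => //.
have Q00 : Q%:F != 0.
  by rewrite tofrac_eq0; apply: contra_neq Q0 => ->; rewrite horner0.
have : P = N * 'X + r%:P * Q.
  by rewrite -[LHS](subrK (r%:P * Q)) PN polyC0 subr0.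
move=> PE; apply: (mulfI X_neq0); rewrite mulrBr gE PE rmorphD !rmorphM.
by rewrite mulrDl mulfK// [_ / 'X%:F]mulrC mulVKf ?X_neq0// addrK; ring.
Qed.

Lemma rat_deriv_XD (a : F) : rat_deriv ('X + a%:P)%:F = 1.
Proof.
have -> : ('X + a%:P)%:F = ('X + a%:P)%:F / 1%:F by rewrite rmorph1 divr1.
rewrite rat_derivE ?oner_neq0// derivD derivX !derivC addr0 mul1r mulr0 subr0.
by rewrite expr1n rmorph1 divr1.
Qed.

Lemma rat_deriv_XV : rat_deriv ('X%:F)^-1 = - ('X%:F ^+ 2)^-1.
Proof.
have -> : ('X%:F)^-1 = 1%:F / 'X%:F by rewrite rmorph1 div1r.
rewrite rat_derivE ?polyX_eq0// derivX !derivC mul0r mul1r sub0r.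
by rewrite rmorphN rmorph1 mulN1r rmorphXn.
Qed.

Lemma germ_fin h a : germ h (Some a) = rat_comp h (chart (Some a)).
Proof. by rewrite /germ /pullback rat_deriv_XD mulr1. Qed.

Lemma germ_inf h :
  'X%:F * germ h None = - (rat_comp h (chart None) / 'X%:F).
Proof.
rewrite /germ /pullback rat_deriv_XV expr2 invfM !mulrN; congr (- _).
by rewrite mulrCA mulVKf ?X_neq0.
Qed.

Section ResidueTheorem.
Hypothesis Fclosed : forall p : {poly F}, size p != 1%N -> exists x, root p x.

Lemma regular_poly h :
  (forall a, exists v, value0 (rat_comp h (chart (Some a))) v) ->
  exists p, h = p%:F.
Proof.
rewrite (fracE h); have := denom_neq0 h; move: (numer h) (denom h) => n d.
have [k] := ubnP (size d); elim: k n d => // k IH n d sd d0 reg.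
have [/size_poly1P[c c0 dc]|/Fclosed[a ra]] := boolP (size d == 1%N).
  exists (c^-1%:P * n); apply/eqP; rewrite dc rmorphM.
  rewrite -(inj_eq (mulIf (_ : c%:P%:F != 0))) ?tofrac_eq0 ?polyC_eq0//.
  rewrite divfK ?tofrac_eq0 ?polyC_eq0// -!rmorphM mulrAC -polyCM mulVf//.
  by rewrite mul1r.
have [v] := reg a; rewrite (rat_compE Fclosed) //; last exact: nonconst_chart.
rewrite /chart !eval_at_comp => nv.
have hc (p : {poly F}) : (p \Po ('X + a%:P)).[0] = p.[a].
  by rewrite horner_comp !hornerE.
have dc0 : d \Po ('X + a%:P) != 0.
  rewrite -tofrac_eq0 -eval_at_comp (eval_at_neq0 Fclosed)//.
  exact: (nonconst_chart (Some a)).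
have := value0_div_eq0 dc0 nv; rewrite !hc => /(_ (eqP ra)) /eqP na.
have [n1 nE] := factor_theorem _ _ na; have [d1 dE] := factor_theorem _ _ ra.
have d10 : d1 != 0 by apply: contra_neq d0 => d10; rewrite dE d10 mul0r.
have E : n%:F / d%:F = n1%:F / d1%:F.
  apply/eqP; rewrite eqr_div ?tofrac_eq0// nE dE -!rmorphM tofrac_eq.
  by apply/eqP; ring.
rewrite E; apply: IH => //; last by move=> b; rewrite -E.
by move: sd; rewrite dE (size_Mmonic d10 (monicXsubC a)) size_XsubC addn2.
Qed.

Lemma poly_at_inf (p : {poly F}) v :
  value0 (eval_at p (chart None) / 'X%:F) v -> p = 0.
Proof.
elim/poly_ind: p v => // p c IH v.
rewrite eval_atD eval_atM eval_atC eval_atX /chart => pv.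
have := value0M (value0_poly 'X) pv; rewrite hornerX mul0r.
rewrite mulrCA mulfV ?X_neq0// mulr1 => pc.
have p0 : p = 0.
  have := value0D pc (value0_poly (- c%:P)); rewrite rmorphN addrK.
  exact: IH.
move: pc; rewrite p0 mul0r add0r {1}/eval_at rmorph0 horner0 mul0r add0r.
by move=> /value0_uniq /(_ (value0_poly c%:P)); rewrite hornerC => <-.
Qed.

Lemma residue_sum0 (I : finType) (h : K) (p : I -> option F) (r : I -> F) :
  injective p -> (forall q, is_pole h q <-> exists i, p i = q) ->
  (forall i, simple_residue h (p i) (r i)) -> \sum_i r i = 0.
Proof.
move=> pinj poles res.
have nc := @nonconst_chart.
pose T i : K := if p i is Some a then const (r i) / ('X - a%:P)%:F else 0.
have TE q i : rat_comp (T i) (chart q) =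
    if p i is Some b then const (r i) / (chart q - const b) else 0.
  rewrite /T; case: (p i) => [b|]; last by rewrite rat_comp0.
  rewrite (rat_compE Fclosed) ?polyXsubC_eq0// eval_atC.
  by rewrite -polyCN eval_atD eval_atX eval_atC rmorphN.
have Treg a i : p i <> Some a ->
    exists v, value0 (rat_comp (T i) (chart (Some a))) v.
  rewrite TE; case: (p i) => [b ba|_]; last first.
    by exists 0; have := value0_poly 0; rewrite rmorph0 horner0.
  have -> : chart (Some a) - const b = ('X + (a - b)%:P)%:F.
    by rewrite polyCB /= !rmorphD/= rmorphN addrA.
  exists (r i * (a - b)^-1); apply: value0M.
    by have := value0_poly (r i)%:P; rewrite hornerC.
  have := @value0V ('X + (a - b)%:P); rewrite !hornerE; apply.
  by rewrite subr_eq0; apply: contra_not_neq ba => ->.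
have [N NE] : exists N, h - \sum_i T i = N%:F.
  apply: regular_poly => a; rewrite (rat_compD Fclosed)//.
  rewrite (rat_compN Fclosed)// (rat_comp_sum Fclosed)//.
  have [[i pi]|npi] := pselect (exists i, p i = Some a).
    rewrite (bigD1 i)//= opprD addrA.
    have [u hu] : exists u, value0 (rat_comp h (chart (Some a))
                                    - rat_comp (T i) (chart (Some a))) u.
      have := res i; rewrite /simple_residue pi germ_fin => /regular_sub_polar.
      rewrite TE pi; have -> // : chart (Some a) - const a = 'X%:F.
      by rewrite /= rmorphD/= addrK.
    have [v Tv] : exists v,
        value0 (\sum_(j | j != i) rat_comp (T j) (chart (Some a))) v.
      apply: regular_sum => j /eqP ji; apply: Treg => pj; apply: ji.
      by apply: pinj; rewrite pj pi.
    by exists (u - v); apply: value0D hu (value0N Tv).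
  have [u hu] : exists u, value0 (rat_comp h (chart (Some a))) u.
    by rewrite -germ_fin; apply: contrapT => /(poles (Some a)).
  have [v Tv] : exists v,
      value0 (\sum_j rat_comp (T j) (chart (Some a))) v.
    by apply: regular_sum => j _; apply: Treg => pj; apply: npi; exists j.
  by exists (u - v); apply: value0D hu (value0N Tv).
have hE : h = N%:F + \sum_i T i by rewrite -NE subrK.
have resinf : value0 ('X%:F * germ h None) (\sum_(i | p i == None) r i).
  have [[i pi]|npi] := pselect (exists i, p i = None).
    rewrite (big_pred1 i) => [|j]; last first.
      by apply/eqP/eqP => [pj|->//]; apply: pinj; rewrite pj pi.
    by have := res i; rewrite /simple_residue pi.
  rewrite big_pred0 => [|j]; last by apply/eqP => pj; apply: npi; exists j.
  have [u hu] : exists u, value0 (germ h None) u.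
    by apply: contrapT => /(poles None).
  by have := value0M (value0_poly 'X) hu; rewrite hornerX mul0r.
move: resinf; rewrite germ_inf => /value0N; rewrite opprK.
rewrite hE (rat_compD Fclosed)// (rat_compP Fclosed)// (rat_comp_sum Fclosed)//.
rewrite mulrDl mulr_suml => NT.
have TV : value0 (\sum_i rat_comp (T i) (chart None) / 'X%:F)
                 (\sum_i (if p i is Some _ then r i else 0)).
  apply: value0_sum => i; rewrite TE; case: (p i) => [b|]; last first.
    by rewrite mul0r; have := value0_poly 0; rewrite rmorph0 horner0.
  have -> : const (r i) / (chart None - const b) / 'X%:F =
            const (r i) * ((1 - b%:P * 'X)%:F)^-1.
    rewrite -mulrA -invfM mulrBl mulVf ?X_neq0// rmorphB rmorph1 rmorphM.
    by [].
  have b1 : (1 - b%:P * 'X).[0] = 1 by rewrite !hornerE ?mulr0 ?subr0.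
  have := @value0V (1 - b%:P * 'X); rewrite b1 => /(_ (oner_neq0 _)).
  move=> /(value0M (value0_poly (r i)%:P)).
  by rewrite hornerC invr1 mulr1.
have := value0D NT (value0N TV); rewrite addrK => NV.
have N0 := poly_at_inf NV.
move: NV; rewrite N0 /eval_at rmorph0 horner0 mul0r => NV.
have := value0_uniq NV (value0_poly 0); rewrite horner0 => /eqP.
rewrite -opprD oppr_eq0 => /eqP E.
rewrite -[RHS]E (bigID (fun i => p i == None))/=; congr (_ + _).
by rewrite big_mkcond; apply: eq_bigr => i _; case: (p i).
Qed.
End ResidueTheorem.
End RationalForms.

Section Spaces.
Variable R : realType.

(* R[i]^o is R[i], seen as a topological field. *)
Local Notation C := (R[i]^o).
Local Notation K := {fraction {poly C}}.

(* The Riemann sphere; None is the point at infinity. *)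
Definition sphere : topologicalType := one_point_compactification C.

Section Omega1.
Variable s : nat.

Definition Conf : set 'rV[sphere]_s := [set p | injective (fun i => p 0 i)].

Definition H : set 'rV[C]_s :=
  [set r | (forall i, r 0 i != 0) /\ \sum_i r 0 i = 0].

Definition marked : topologicalType := (H * Conf)%type.

(* The symmetric group permutes the residues and the poles simultaneously. *)
Definition perm_rel (x y : marked) : Prop :=
  exists sigma : 'S_s, \val y.1 = col_perm sigma (\val x.1) /\
                       \val y.2 = col_perm sigma (\val x.2).

Definition residue_space : topologicalType := quotient_space perm_rel.

Definition poles_are (h : K) (p : 'rV[sphere]_s) : Prop :=
  forall q : sphere, is_pole h q <-> exists i, p 0 i = q.

(* The rational 1-forms with exactly s poles, all simple. *)
Definition Omega1 : set K :=
  [set h | exists p : 'rV[sphere]_s,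
    [/\ Conf p, poles_are h p & forall i, simple_pole h (p 0 i)]].

Definition residue_data (h : K) (x : marked) : Prop :=
  poles_are h (\val x.2) /\
  forall i, simple_residue h (\val x.2 0 i) (\val x.1 0 i).

Lemma residue_data_ex (h : Omega1) : exists x, residue_data (\val h) x.
Proof.
case: h => h /= hO.
have [p [pC poles /all_and2[pole /choice[r res]]]] := set_mem hO.
have rH : H (\row_i r i).
  split=> [i|]; last first.
    under eq_bigr do rewrite mxE.
    apply: residue_sum0 pC poles res => q sq.
    by have /closed_rootP : size (q : {poly R[i]}) != 1%N by [].
  rewrite mxE; apply/eqP => r0; have := res i.
  rewrite r0 => /regular_sub_polar; rewrite raddf0 mul0r subr0.
  exact: pole.
exists (SigSub (mem_set rH) : H, SigSub (mem_set pC) : Conf); split => //= i.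
by rewrite mxE.
Qed.

(* The bijection from 1-forms to classes <r_1,..,r_s; p_1,..,p_s>; the class
   does not depend on the chosen enumeration of the poles. *)
Definition residue_class (h : Omega1) : residue_space :=
  quotient_map perm_rel (projT1 (cid (residue_data_ex h))).

(* The topology that makes this bijection a homeomorphism. *)
Definition Omega1_space : topologicalType := initial_topology residue_class.

(* Orbits of PSL(2,C); M and -M induce the same Moebius transformation. *)
Definition psl_rel (h h' : Omega1_space) : Prop :=
  exists M : 'M[C]_2, \det M = 1 /\
    \val (h' : Omega1) = pushforward M (\val (h : Omega1)).

Definition Omega1_mod_PSL : topologicalType := quotient_space psl_rel.

End Omega1.

(* The space M(-s) for s = n + 4.  The coordinates of the second factor are
   p_4, .., p_s: coordinate i : 'I_n.+1 is the point with label i + 4. *)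
Section NormalForms.
Variable n : nat.
Local Notation s := n.+4.

Definition Aset : set 'cV[C]_n.+3 :=
  [set r | \sum_i r i 0 != 0 /\ forall i, r i 0 != 0].

Definition Pset : set 'rV[C]_n.+1 :=
  [set p | (forall i, p 0 i != 0 /\ p 0 i != 1) /\ injective (fun i => p 0 i)].

Definition Mspace : topologicalType := (Aset * Pset)%type.

(* Labels and indices start from 0 here: "coxeter j" is the transposition
   written sigma_(j+1) = (j+1 j+2) with labels 1, .., s, and likewise for
   "coxeter_A j" and "coxeter_f j". *)
Definition coxeter (j : 'I_n.+3) : 'S_s := tperm (inord j) (inord j.+1).

Definition coxeter_A (j : 'I_n.+3) : 'M[int]_n.+3 :=
  if (j < n.+2)%N then xrow (inord j) (inord j.+1) 1%:M
  else \matrix_(i, k) (if i == ord_max then -1 else (i == k)%:R).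

Definition coxeter_f (j : 'I_n.+3) (z : 'rV[C]_n.+1) : 'rV[C]_n.+1 :=
  match nat_of_ord j with
  | 0 => \row_i (z 0 i)^-1
  | 1 => \row_i (z 0 i / (z 0 i - 1))
  | 2 => \row_i (if i == ord0 then (z 0 ord0)^-1 else z 0 i / z 0 ord0)
  | _ => \row_i z 0 (inord (coxeter j (inord (i + 3)) - 3))
  end.

(* f is given by rational functions that are regular on Pset. *)
Definition rational_map (f : Pset -> Pset) : Prop :=
  forall i, exists P Q : mpoly.mpoly n.+1 C, forall z : Pset,
    mpoly.meval (fun k => \val z 0 k) Q != 0 /\
    \val (f z) 0 i = mpoly.meval (fun k => \val z 0 k) P /
                     mpoly.meval (fun k => \val z 0 k) Q.

Definition birational (f : Pset -> Pset) : Prop :=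
  rational_map f /\
  exists g, [/\ rational_map g, cancel f g & cancel g f].

Definition zmatrix (A : 'M[int]_n.+3) : 'M[C]_n.+3 := map_mx intr A.

Definition rep_data : Type :=
  (('S_s -> 'M[int]_n.+3) * ('S_s -> Pset -> Pset))%type.

(* rho is the representation sigma |-> (A_sigma, f_sigma).  The product of 'S_s
   is composition in diagrammatic order: (tau * sigma) i = sigma (tau i). *)
Record coxeter_rep (rho : rep_data) : Prop := {
  rep_unit : forall sigma, rho.1 sigma \in unitmx;
  rep_birational : forall sigma, birational (rho.2 sigma);
  rep_A1 : rho.1 1%g = 1%:M;
  rep_f1 : rho.2 1%g = id;
  rep_AM : forall sigma tau, rho.1 (tau * sigma)%g = rho.1 sigma *m rho.1 tau;
  rep_fM : forall sigma tau, rho.2 (tau * sigma)%g = rho.2 sigma \o rho.2 tau;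
  rep_stable : forall sigma (r : Aset),
    Aset (zmatrix (rho.1 sigma) *m \val r);
  rep_coxeter_A : forall j, rho.1 (coxeter j) = coxeter_A j;
  rep_coxeter_f : forall j z, \val (rho.2 (coxeter j) z) = coxeter_f j (\val z)
}.

Definition orbit_rel (rho : rep_data) (x y : Mspace) : Prop :=
  exists sigma : 'S_s, \val y.1 = zmatrix (rho.1 sigma) *m \val x.1 /\
                       y.2 = rho.2 sigma x.2.

Definition Mspace_mod_S (rho : rep_data) : topologicalType :=
  quotient_space (orbit_rel rho).

End NormalForms.
End Spaces.

Arguments Omega1_mod_PSL : clear implicits.
Arguments rep_data : clear implicits.
Arguments coxeter_rep : clear implicits.
Arguments Mspace_mod_S : clear implicits.

(* Main.v *)
From HB Require Import structures.
From Stdlib Require Import Relation_Operators.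
From mathcomp Require Import all_boot all_order all_algebra all_fingroup.
From mathcomp Require Import all_classical all_reals all_analysis.
From mathcomp Require Import complex ring zify.
From mathcomp Require mpoly.
Require Import Defs.
Import (canonicals) mpoly.

Set Implicit Arguments.
Unset Strict Implicit.
Unset Printing Implicit Defensive.

Import Order.TTheory GRing.Theory Num.Theory.
Import numFieldNormedType.Exports.

Local Open Scope classical_set_scope.
Local Open Scope complex_scope.
Local Open Scope ring_scope.

(** Both quotients are realized by explicit maps between the space of marked
    forms, that is, of ordered tuples (r_1, .., r_s; p_1, .., p_s), and the
    space M(-s).

    A form with simple poles is determined by its residue data: it is
    sum_i r_i dz / (z - p_i) (residue_data_form), because the difference of two
    forms with the same residues is regular everywhere, hence 0.  Writing
    dz / (z - p) as the logarithmic derivative of the bracket [z, p] of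
    homogeneous coordinates makes sense for p = oo too, where it vanishes.  In
    this form the push-forward by a Moebius transformation M is immediate: M
    multiplies [z, p] by a factor depending on z times one depending on p
    (bracket_mob), so each term moves to the pole M p up to a term that does
    not depend on p, and these extra terms cancel because the residues sum to 0
    (pushforward_residue_form).  Hence PSL(2,C) moves the poles and keeps the
    residues.

    PSL(2,C) is simply transitive on triples of distinct points.  Moving the
    first three poles to 0, oo, 1 sends the others to cross ratios, which are
    Moebius invariants (cross_ratio_mob, std_cross_ratios).  So the orbit
    of a marked form contains exactly one normalized form, given by the map
    normalize; the map marked_of is the inclusion of the normalized ones.
    Relabelling the poles and normalizing again is the action of S(s) on
    M(-s): on residues it gives integral matrices, since r_s is minus the sum
    of the others, and on poles it gives quotients of products of brackets.
    That it is an action follows from the invariance of cross ratios.  It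
    takes the prescribed values on the Coxeter generators, and no other
    representation does, because they generate S(s) (coxeter_ind).

    Both maps descend to the quotients, where they are inverse to each other;
    by the universal property of quotients it remains to see that they are
    continuous before descending.  The only delicate point is the continuity
    of the cross ratio at infinity (cross_ratio_continuous): four points of
    the sphere avoid some finite z0, and in the coordinate 1/(z - z0) the
    cross ratio is the usual rational function of finite points. *)

(** * Brackets, Moebius transformations and cross ratios *)

Section ProjectiveLine.
Variable F : fieldType.
Implicit Types (p q a b c d : option F) (M : 'M[F]_2).

(** Homogeneous coordinates: (a : 1) for a finite point a, (1 : 0) for infinity. *)
Definition hom_x p : F := if p is Some z then z else 1.
Definition hom_y p : F := if p is Some _ then 1 else 0.

Definition bracket p q : F := hom_x p * hom_y q - hom_y p * hom_x q.

Lemma bracket_eq0 p q : (bracket p q == 0) = (p == q).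
Proof.
rewrite /bracket; case: p q => [z|] [w|] /=.
- by rewrite mulr1 mul1r subr_eq0 -(inj_eq Some_inj).
- by rewrite mulr0 mulr1 sub0r oppr_eq0 oner_eq0.
- by rewrite mul0r mulr1 subr0 oner_eq0.
- by rewrite mulr0 mul0r subr0 !eqxx.
Qed.

Lemma bracket_id p : bracket p p = 0.
Proof. by rewrite /bracket; ring. Qed.

Definition point (x y : F) : option F := if y == 0 then None else Some (x / y).

(** The scalar l expresses that homogeneous coordinates are only defined up to
    a nonzero factor; it cancels in every homogeneous expression below. *)
Lemma pointP x y : (x != 0) || (y != 0) ->
  exists2 l, l != 0 & x = l * hom_x (point x y) /\ y = l * hom_y (point x y).
Proof.
rewrite /point; case: (eqVneq y 0) => [->|y0 _] /=; first rewrite orbF => x0.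
  by exists x => //; rewrite mulr1 mulr0.
by exists y => //; rewrite mulr1 mulrC divfK.
Qed.

Lemma pointZ l x y : l != 0 -> point (l * x) (l * y) = point x y.
Proof.
move=> l0; rewrite /point mulf_eq0 (negbTE l0) /=.
by case: eqVneq => // y0; rewrite -mulf_div divff ?mul1r.
Qed.

Definition mob_x M p := M 0 0 * hom_x p + M 0 1 * hom_y p.
Definition mob_y M p := M 1 0 * hom_x p + M 1 1 * hom_y p.
Definition mob M p := point (mob_x M p) (mob_y M p).

Lemma det_mx22 M : \det M = M 0 0 * M 1 1 - M 0 1 * M 1 0.
Proof.
rewrite (expand_det_row _ ord0) !big_ord_recl big_ord0 /cofactor !det_mx11 !mxE.
rewrite /= !expr0 expr1 !mul1r addr0 mulN1r mulrN.
by congr (M _ _ * M _ _ - M _ _ * M _ _); apply/val_inj.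
Qed.

Lemma mobP M p : \det M != 0 ->
  exists2 l, l != 0 &
    mob_x M p = l * hom_x (mob M p) /\ mob_y M p = l * hom_y (mob M p).
Proof.
move=> M0; apply: pointP; apply: contraNT M0.
rewrite negb_or !negbK /mob_x /mob_y det_mx22 => /andP[/eqP x0 /eqP y0].
case: p x0 y0 => [z|] /=; rewrite !(mulr1, mulr0, addr0).
  move=> /eqP; rewrite addr_eq0 => /eqP x0 /eqP; rewrite addr_eq0 => /eqP y0.
  by apply/eqP; rewrite -[M 0 1]opprK -[M 1 1]opprK -x0 -y0; ring.
by move=> -> ->; rewrite mul0r mulr0 subr0.
Qed.

(** Brackets are determinants, so a matrix multiplies them by its own
    determinant; the factor l comes from renormalizing the coordinates. *)
Lemma bracket_mob M : \det M != 0 ->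
  exists2 l : option F -> F, forall p, l p != 0 &
  forall p q, bracket (mob M p) (mob M q) = \det M / (l p * l q) * bracket p q.
Proof.
move=> M0; have /choice[l lP] : forall p, exists l, l != 0 /\
    mob_x M p = l * hom_x (mob M p) /\ mob_y M p = l * hom_y (mob M p).
  by move=> p; have [l l0 E] := mobP p M0; exists l.
exists l => [p|p q]; first by case: (lP p).
have [p0 [px py]] := lP p; have [q0 [qx qy]] := lP q.
have E : l p * l q * bracket (mob M p) (mob M q) = \det M * bracket p q.
  transitivity (mob_x M p * mob_y M q - mob_y M p * mob_x M q).
    by rewrite px py qx qy /bracket; ring.
  by rewrite /mob_x /mob_y det_mx22 /bracket; ring.
apply: (mulfI (mulf_neq0 p0 q0)); rewrite E; field.
by rewrite p0 q0.
Qed.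

Lemma mob_inj M : \det M != 0 -> injective (mob M).
Proof.
move=> M0 p q pq; have [l l0 E] := bracket_mob M0; have := E p q.
rewrite pq bracket_id => /esym/eqP; rewrite !mulf_eq0 invr_eq0 mulf_eq0.
by rewrite (negbTE M0) !(negbTE (l0 _)) bracket_eq0 => /eqP.
Qed.

Lemma mobZ k M p : k != 0 -> mob (k *: M) p = mob M p.
Proof.
move=> k0; rewrite /mob -[RHS](pointZ _ _ k0); congr point;
  by rewrite /mob_x /mob_y !mxE; ring.
Qed.

(** The value at q of the Moebius transformation sending a, b, c to 0, oo, 1. *)
Definition cross_ratio a b c q : F :=
  bracket q a * bracket c b / (bracket q b * bracket c a).

(** Each point occurs as often in the numerator as in the denominator, so the
    factors of bracket_mob cancel.  In the degenerate cases both
    denominators vanish, and both sides are 0. *)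
Lemma cross_ratio_mob M a b c q : \det M != 0 ->
  cross_ratio (mob M a) (mob M b) (mob M c) (mob M q) = cross_ratio a b c q.
Proof.
move=> M0; have [l l0 E] := bracket_mob M0; rewrite /cross_ratio !E.
have [->|qb] := eqVneq (bracket q b) 0.
  by rewrite !(mulr0, mul0r) invr0 !mulr0.
have [->|ca] := eqVneq (bracket c a) 0.
  by rewrite !mulr0 invr0 !mulr0.
by field; rewrite qb ca M0 !l0.
Qed.

(** The matrix of the transformation sending a, b, c to 0, oo, 1. *)
Definition norm_mx a b c : 'M[F]_2 := \matrix_(i, j)
  if i == 0 then bracket c b * (if j == 0 then hom_y a else - hom_x a)
  else bracket c a * (if j == 0 then hom_y b else - hom_x b).

Lemma norm_mxE a b c q : a != b -> a != c -> b != c ->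
  mob (norm_mx a b c) q =
  point (bracket q a * bracket c b) (bracket q b * bracket c a).
Proof.
move=> ab ac bc; congr point; rewrite /mob_x /mob_y !mxE /= /bracket;
  by ring.
Qed.

Lemma det_norm_mx a b c : a != b -> a != c -> b != c -> \det (norm_mx a b c) != 0.
Proof.
move=> ab ac bc; rewrite det_mx22 !mxE /=.
rewrite (_ : _ - _ = bracket c b * bracket c a * bracket a b).
  by rewrite !mulf_neq0 ?bracket_eq0// eq_sym.
by rewrite /bracket; ring.
Qed.

Lemma mob_norm_mx a b c q : a != b -> a != c -> b != c ->
  q != b -> mob (norm_mx a b c) q = Some (cross_ratio a b c q).
Proof.
move=> ab ac bc qb; rewrite norm_mxE// /point mulf_eq0 !bracket_eq0.
by rewrite (negbTE qb) eq_sym (negbTE ac).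
Qed.

Lemma mob_norm_mx_inf a b c : a != b -> a != c -> b != c ->
  mob (norm_mx a b c) b = None.
Proof. by move=> ab ac bc; rewrite norm_mxE// /point bracket_id mul0r eqxx. Qed.

Lemma cross_ratio0 a b c : cross_ratio a b c a = 0.
Proof. by rewrite /cross_ratio bracket_id !mul0r. Qed.

Lemma cross_ratio1 a b c : a != c -> b != c -> cross_ratio a b c c = 1.
Proof.
move=> ac bc; rewrite /cross_ratio [X in X / _]mulrC divff//.
by rewrite mulf_neq0 ?bracket_eq0// eq_sym.
Qed.

End ProjectiveLine.

(** * Forms with simple poles as sums of logarithmic derivatives *)

(** Logarithmic derivative of the transformed linear form: with the matrix
    (m00 m01; m10 m11), whose inverse map is N / D, the left-hand side is the
    pull-back by N / D of dlog at the point (x : y), the first term on the right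
    is dlog at its image (u : v), and the second one is dlog at the image of
    infinity. *)
Lemma moebius_dlog_identity (E : fieldType) (m00 m01 m10 m11 x y X : E) :
  let D := - m10 * X + m00 in let N := m11 * X - m01 in
  let u := m00 * x + m01 * y in let v := m10 * x + m11 * y in
  D != 0 -> v * X - u != 0 -> m10 * X - m00 != 0 ->
  y / (y * (N / D) - x) * ((m11 * D - N * - m10) / D ^+ 2) =
  v / (v * X - u) - m10 / (m10 * X - m00).
Proof.
by rewrite /= => D0 V0 I0; field; rewrite I0 V0 D0.
Qed.

Section Forms.
Variable F : fieldType.
Local Notation K := {fraction {poly F}}.
Local Notation "x %:F" := (@FracField.tofrac {poly F} x).
Hypothesis Fclosed : forall p : {poly F}, size p != 1%N -> exists x, root p x.
Implicit Types (p q : option F) (M : 'M[F]_2).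

(** Logarithmic derivative of z |-> [z, p], that is 1/(z - p) if p is finite
    and 0 if p is infinity. *)
Definition dlog p : K :=
  const (hom_y p) / (const (hom_y p) * 'X%:F - const (hom_x p)).

Lemma lin_neq0 (x y : F) :
  (x != 0) || (y != 0) -> const y * 'X%:F - const x != 0 :> K.
Proof.
rewrite /const -rmorphM -rmorphB tofrac_eq0 => xy; apply: contraTneq xy => E.
have := congr1 (fun P : {poly F} => (P`_0, P`_1)) E.
rewrite !coefB !coefCM !coefX !coefC /= mulr0 mulr1 subr0 sub0r => -[].
by move=> /eqP; rewrite oppr_eq0 => /eqP -> ->; rewrite eqxx.
Qed.

Lemma hom_neq0 p : (hom_x p != 0) || (hom_y p != 0).
Proof. by case: p => [z|] /=; rewrite oner_eq0 ?orbT. Qed.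

Lemma dlogZ l p x y : l != 0 -> x = l * hom_x p -> y = l * hom_y p ->
  dlog p = const y / (const y * 'X%:F - const x).
Proof.
move=> l0 -> ->; have := lin_neq0 (hom_neq0 p); rewrite /dlog !rmorphM => n0.
have l1 : const l != 0 by rewrite fmorph_eq0.
by rewrite -[const l * _ * 'X%:F]mulrA -mulrBr -[RHS]mulf_div divff// mul1r.
Qed.

Lemma rat_comp_dlog p phi : nonconst phi ->
  rat_comp (dlog p) phi =
  const (hom_y p) / (const (hom_y p) * phi - const (hom_x p)).
Proof.
move=> nc; rewrite /dlog /const -rmorphM -rmorphB rat_compE//; last first.
  by have := lin_neq0 (hom_neq0 p); rewrite /const -rmorphM -rmorphB tofrac_eq0.
by rewrite eval_atC -polyCN eval_atD eval_atM !eval_atC eval_atX rmorphN.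
Qed.

Lemma rat_compZ (c : F) (h phi : K) : nonconst phi ->
  rat_comp (const c * h) phi = const c * rat_comp h phi.
Proof.
move=> nc; rewrite [h in LHS]fracE /const mulrA -rmorphM rat_compE ?denom_neq0//.
by rewrite eval_atM eval_atC mulrA.
Qed.

Definition residue_form (I : finType) (r : I -> F) (p : I -> option F) : K :=
  \sum_i const (r i) * dlog (p i).

Lemma rat_comp_residue_form (I : finType) (r : I -> F) (p : I -> option F) phi :
  nonconst phi -> rat_comp (residue_form r p) phi =
  \sum_i const (r i) * rat_comp (dlog (p i)) phi.
Proof.
move=> nc; rewrite rat_comp_sum//; apply: eq_bigr => i _; exact: rat_compZ.
Qed.

Lemma invmx_det1 M : \det M = 1 ->
  [/\ invmx M 0 0 = M 1 1, invmx M 0 1 = - M 0 1,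
      invmx M 1 0 = - M 1 0 & invmx M 1 1 = M 0 0].
Proof.
move=> M1.
(* In 'I_2 the index 1 - i is the one different from i: N is the adjugate. *)
pose N : 'M[F]_2 := \matrix_(i, j)
  (if i == j then M (1 - i) (1 - j) else - M i j).
have MN : M *m N = 1%:M.
  move: M1; rewrite det_mx22 => M1; apply/matrixP => i j.
  rewrite !mxE !big_ord_recl big_ord0 addr0 !mxE.
  have E (P : 'I_2 -> Prop) : P 0 -> P 1 -> forall i, P i.
    move=> P0 P1 [[|[|//]] ik]; [move: P0|move: P1];
    by congr (P _); apply/val_inj.
  have e : lift ord0 ord0 = 1 :> 'I_2 by apply/val_inj.
  rewrite e; move: i j; do 2! [elim/E];
  by rewrite /= ?subr0 ?subrr ?sub0r -?M1; ring.
have uM : M \in unitmx by rewrite unitmxE M1 unitr1.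
have -> : invmx M = N by rewrite -[LHS]mulmx1 -MN mulKmx.
by split; rewrite mxE /= ?subr0 ?subrr.
Qed.

Lemma nonconst_moebius M : \det M = 1 -> nonconst (moebius (invmx M)).
Proof.
move=> M1 c; have [E00 E01 E10 E11] := invmx_det1 M1.
move: M1; rewrite det_mx22 => M1.
rewrite /moebius E00 E01 E10 E11; apply/eqP.
have d0 : (- M 1 0 *: 'X + (M 0 0)%:P)%:F != 0 :> K.
  rewrite tofrac_eq0; apply: contra_eq_neq M1 => E.
  have := congr1 (fun P : {poly F} => (P`_0, P`_1)) E.
  rewrite !coefD !coefZ !coefX !coefC /= mulr0 mulr1 addr0 add0r => -[-> /eqP].
  by rewrite oppr_eq0 => /eqP ->; rewrite mul0r mulr0 subr0 eq_sym oner_eq0.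
move=> /(canRL (divfK d0)); rewrite /const -rmorphM => /eqP.
rewrite tofrac_eq => /eqP E.
have := congr1 (fun P : {poly F} => (P`_0, P`_1)) E.
rewrite !coefCM !coefD !coefZ !coefX !coefC /= !(mulr0, mulr1) !addr0 !add0r.
move=> -[m01 m11]; move/eqP: M1; apply/negP; rewrite m11.
rewrite (_ : _ - _ = (- M 0 1 - c * M 0 0) * M 1 0); last by ring.
by rewrite m01 subrr mul0r eq_sym oner_eq0.
Qed.

Lemma linE (a b : F) : (a *: 'X + b%:P)%:F = const a * 'X%:F + const b.
Proof. by rewrite -mul_polyC rmorphD rmorphM. Qed.

Lemma rat_deriv_lin (a b c d : F) : c *: 'X + d%:P != 0 ->
  rat_deriv ((a *: 'X + b%:P)%:F / (c *: 'X + d%:P)%:F) =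
  (const a * (c *: 'X + d%:P)%:F - (a *: 'X + b%:P)%:F * const c) /
  (c *: 'X + d%:P)%:F ^+ 2.
Proof.
move=> d0; rewrite rat_derivE// !derivD !derivZ !derivX !derivC !addr0.
by rewrite !alg_polyC rmorphB !rmorphM.
Qed.

Lemma mob_lin_neq0 M p : \det M != 0 ->
  const (mob_y M p) * 'X%:F - const (mob_x M p) != 0.
Proof.
move=> M0; have [l l0 [-> ->]] := mobP p M0.
by rewrite lin_neq0// !mulf_eq0 !(negbTE l0) hom_neq0.
Qed.

(** The second term does not depend on p: it comes from the denominator of the
    inverse transformation, which vanishes at the image of infinity. *)
Lemma pushforward_dlog M p : \det M = 1 ->
  pushforward M (dlog p) = dlog (mob M p) - dlog (mob M None).
Proof.
move=> M1; have M0 : \det M != 0 by rewrite M1 oner_eq0.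
have [E00 E01 E10 E11] := invmx_det1 M1.
have [l l0 [lx ly]] := mobP p M0; have [k k0 [kx ky]] := mobP None M0.
have dp := mob_lin_neq0 p M0; have dn := mob_lin_neq0 None M0.
rewrite (dlogZ l0 lx ly) (dlogZ k0 kx ky).
have nc := nonconst_moebius M1.
have d0 : - M 1 0 *: 'X + (M 0 0)%:P != 0 :> {poly F}.
  rewrite -tofrac_eq0 linE; move: dn; rewrite -oppr_eq0 /mob_x /mob_y /=.
  by rewrite !mulr1 !mulr0 !addr0 opprB rmorphN mulNr addrC.
rewrite /pushforward /pullback rat_comp_dlog//.
rewrite /moebius E00 E01 E10 E11 rat_deriv_lin// !linE.
move: d0 dp dn; rewrite -tofrac_eq0 linE /mob_x /mob_y /= !mulr1 !mulr0 !addr0.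
rewrite !rmorphD !rmorphM !rmorphN => d0 dp dn.
have /= := @moebius_dlog_identity K (const (M 0 0)) (const (M 0 1))
  (const (M 1 0)) (const (M 1 1)) (const (hom_x p)) (const (hom_y p)) 'X%:F.
by move=> /(_ d0 dp dn).
Qed.

(** The terms at the image of infinity add up to a multiple of sum_i r_i = 0. *)
Lemma pushforward_residue_form (I : finType) (r : I -> F) (p : I -> option F) M :
  \det M = 1 -> \sum_i r i = 0 ->
  pushforward M (residue_form r p) = residue_form r (mob M \o p).
Proof.
move=> M1 r0; rewrite /pushforward /pullback rat_comp_residue_form; last first.
  exact: nonconst_moebius.
rewrite mulr_suml.
under eq_bigr do
  rewrite -mulrA [_ * rat_deriv _]pushforward_dlog// mulrBr.
by rewrite sumrB -[X in _ - X]mulr_suml -rmorph_sum r0 rmorph0 mul0r subr0.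
Qed.

Lemma simple_residueD h h' q (r r' : F) :
  simple_residue h q r -> simple_residue h' q r' ->
  simple_residue (h + h') q (r + r').
Proof.
rewrite /simple_residue /germ /pullback (rat_compD Fclosed); last first.
  exact: nonconst_chart.
by rewrite mulrDl mulrDr; exact: value0D.
Qed.

Lemma value0_cst (c : F) : value0 (const c) c.
Proof. by have := value0_poly c%:P; rewrite hornerC. Qed.

Lemma simple_residueZ c h q (r : F) :
  simple_residue h q r -> simple_residue (const c * h) q (c * r).
Proof.
move=> hr; rewrite /simple_residue /germ /pullback rat_compZ; last first.
  exact: nonconst_chart.
by rewrite -[const c * _ * _]mulrA mulrCA; exact: value0M (value0_cst c) hr.
Qed.

(** The form dz / (z - p) has residue 1 at a finite p, and then -1 at infinity.
    The formula also covers p = oo, where both terms cancel. *)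
Lemma simple_residue_dlog p q :
  simple_residue (dlog p) q ((p == q)%:R - (q == None)%:R).
Proof.
rewrite /simple_residue; case: q => [a|]; last first.
  rewrite germ_inf rat_comp_dlog; last exact: nonconst_chart.
  case: p => [b|] /=; last first.
    rewrite subrr rmorph0 !mul0r oppr0; have := value0_cst 0.
    by rewrite rmorph0.
  rewrite sub0r; apply: value0N.
  have b1 : (1 - b%:P * 'X).[0] = 1 by rewrite !hornerE ?mulr0 ?subr0.
  have := @value0V _ (1 - b%:P * 'X); rewrite b1 invr1 => /(_ (oner_neq0 _)).
  congr value0; rewrite rmorph1 !mul1r -invfM mulrBl mulVf ?X_neq0//.
  by rewrite rmorphB rmorph1 rmorphM.
rewrite germ_fin rat_comp_dlog; last exact: nonconst_chart.
rewrite subr0; case: p => [b|] /=; last first.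
  rewrite rmorph0 !mul0r mulr0; have := value0_cst 0.
  by rewrite rmorph0.
rewrite rmorph1 !mul1r (inj_eq Some_inj) -rmorphB -addrA -polyCB.
have [->|ba] := eqVneq b a.
  rewrite subrr addr0 divff ?X_neq0//; have := value0_cst 1.
  by rewrite rmorph1.
have -> : 0%:R = 0 * (a - b)^-1 :> F by rewrite mul0r.
apply: value0M; first by have := value0_poly ('X : {poly F}); rewrite hornerX.
have := @value0V _ ('X + (a - b)%:P); rewrite !hornerE; apply.
by rewrite subr_eq0 eq_sym.
Qed.

Lemma simple_residue_residue_form (I : finType) (r : I -> F) (p : I -> option F) q :
  \sum_i r i = 0 ->
  simple_residue (residue_form r p) q (\sum_i r i * (p i == q)%:R).
Proof.
move=> r0; have -> : \sum_i r i * (p i == q)%:R =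
    \sum_i r i * ((p i == q)%:R - (q == None)%:R).
  by under [RHS]eq_bigr do rewrite mulrBr; rewrite sumrB -mulr_suml r0 mul0r subr0.
rewrite /residue_form; elim/big_ind2: _ => [|x1 x2 y1 y2|i _].
- have := simple_residueZ 0 (simple_residue_dlog None q).
  by rewrite rmorph0 !mul0r.
- exact: simple_residueD.
- exact/simple_residueZ/simple_residue_dlog.
Qed.

(** A simple pole with residue 0 is no pole, and a regular germ has residue 0. *)
Lemma is_poleP h q (r : F) : simple_residue h q r -> is_pole h q <-> r != 0.
Proof.
move=> hr; split=> [pole|r0 [v hv]].
  apply/eqP => r0; apply: pole; move: hr; rewrite r0 => /regular_sub_polar.
  by rewrite rmorph0 mul0r subr0.
have := value0M (value0_poly 'X) hv; rewrite hornerX mul0r.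
by move=> /(value0_uniq hr) /eqP; apply/negP.
Qed.

(** The difference of two such forms has no pole, so it is a polynomial that
    vanishes to second order at infinity. *)
Lemma eq_residues h h' (rho : option F -> F) :
  (forall q, simple_residue h q (rho q)) ->
  (forall q, simple_residue h' q (rho q)) -> h = h'.
Proof.
move=> hr h'r; apply/eqP; rewrite -subr_eq0.
have gr q : simple_residue (h - h') q 0.
  have -> : h - h' = h + const (-1) * h' by rewrite rmorphN rmorph1 mulN1r.
  rewrite -(subrr (rho q)) -[- rho q]mulN1r; apply: simple_residueD => //.
  exact: simple_residueZ.
have [P PE] : exists P, h - h' = P%:F.
  apply: regular_poly => // a; rewrite -germ_fin; apply: contrapT.
  by move=> /(is_poleP (gr (Some a))); rewrite eqxx.
have := gr None; rewrite /simple_residue germ_inf PE rat_compP//; last first.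
  exact: (nonconst_chart None).
by move=> /value0N; rewrite opprK => /poly_at_inf ->; rewrite tofrac0.
Qed.

End Forms.

(** * Continuity of the cross ratio on the Riemann sphere *)

Section SphereTopology.
Variable R : realType.
Local Notation C := (R[i]^o).
Local Notation sphere := (sphere R).

Lemma real_complex_continuous : continuous (fun x : R => x%:C : C).
Proof.
move=> x; apply/cvgrPdist_lt => e e0 /=.
have eE : e = (complex.Re e)%:C by rewrite RRe_real// gtr0_real.
have e0' : 0 < complex.Re e by move: e0; rewrite eE ltcR.
near=> t; rewrite eE -rmorphB normc_def /= expr0n addr0 sqrtr_sqr ltcR.
by near: t; apply: (@cvgr_dist_lt _ _ _ _ _ id x) => //; exact: cvg_id.
Unshelve. all: by end_near. Qed.

(** A compact set containing a given disk; its complement is a neighbourhood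
    of infinity.  The square is used because it is visibly a continuous image of
    a product of segments. *)
Definition square (M : R) : set C :=
  (fun xy : R * R => (xy.1%:C + 'i * xy.2%:C)%R : C) @` (`[- M, M] `*` `[- M, M]).

Lemma compact_square M : compact (square M).
Proof.
apply: continuous_compact; last first.
  by apply: compact_setX; exact: segment_compact.
apply: continuous_subspaceT => -[x y].
apply: cvgD.
  apply: (continuous_comp (@cvg_fst _ _ _ _ _)); exact: real_complex_continuous.
apply: cvgMr.
by apply: (continuous_comp (@cvg_snd _ _ _ _ _)); exact: real_complex_continuous.
Qed.

Lemma closed_square M : closed (square M).
Proof.
apply: compact_closed; last exact: compact_square.
exact: norm_hausdorff.
Qed.

Lemma square_ball M (z : C) : `|z| <= M%:C -> square M z.
Proof.
move=> zM; exists (complex.Re z, complex.Im z); last first.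
  by rewrite /= [RHS]complexE.
move: zM; rewrite normc_def lecR => zM.
by split; rewrite /= in_itv /= -ler_norml -sqrtr_sqr; apply: le_trans zM;
  rewrite ler_wsqrtr ?lerDl ?lerDr ?sqr_ge0.
Qed.

(** The coordinate 1/(z - z0), a homeomorphism from the sphere minus z0 to the
    plane. *)
Definition chart_at (z0 : C) (p : sphere) : C :=
  if p is Some z then (z - z0)^-1 else 0.

Lemma near_neq_some (z0 : C) (p : sphere) :
  p <> Some z0 -> \forall q \near p, q <> Some z0.
Proof.
case: p => [z zz0|_].
  suff : \forall w \near z, w != z0 by apply: filterS => w /eqP wz [].
  have /cvgrPdist_lt : id @ z --> z by exact: cvg_id.
  have z0p : 0 < `|z - z0|.
    by rewrite normr_gt0 subr_eq0; apply/eqP => E; apply: zz0; rewrite E.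
  move=> /(_ _ z0p); apply: filterS => w /=.
  by apply: contraTneq => ->; rewrite ltxx.
exists [set z0].
  split; first exact: compact_set1.
  by apply: compact_closed; [exact: norm_hausdorff|exact: compact_set1].
by move=> [w|] // [[v vz [<-]]|//]; apply: contra_not vz => -[].
Qed.

(** At infinity: 1/(z - z0) is smaller than e once z leaves the disk of radius
    1/e + |z0|, hence off a compact square. *)
Lemma chart_at_continuous z0 (p : sphere) : p <> Some z0 ->
  {for p, continuous (chart_at z0)}.
Proof.
case: p => [z zz0|_].
  have {}zz0 : z - z0 != 0.
    by rewrite subr_eq0; apply/eqP => E; apply: zz0; rewrite E.
  have : {for z, continuous (fun w : C => (w - z0)^-1 : C)}.
    apply: continuousV => //.
    apply: (@continuousB _ _ _ id (fun=> z0)); first exact: cvg_id.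
    exact: cst_continuous.
  exact.
have FF : Filter (nbhs (None : sphere)) by exact: nbhs_filter.
rewrite /prop_for /continuous_at [chart_at z0 None]/=.
apply/(@cvgr0Pnorm_lt _ _ _ (nbhs (None : sphere)) FF) => e e0.
have eE : e = (complex.Re e)%:C by rewrite RRe_real// gtr0_real.
pose M : R := complex.Re (e^-1 + `|z0|).
have Mr : e^-1 + `|z0| \is Num.real.
  by apply: realD; [rewrite realV gtr0_real|exact: normr_real].
have ME : M%:C = e^-1 + `|z0| by rewrite RRe_real.
exists (square M); first by split; [exact: compact_square|exact: closed_square].
move=> [w|]; last by rewrite /= normr0.
move=> [[v vz [<-]]|//]; have {vz} : ~~ (`|v| <= M%:C).
  by apply/negP; apply: contra_not vz; exact: square_ball.
rewrite -real_ltNge; [|by rewrite ME|exact: normr_real].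
rewrite ME -ltrBDr => vz /=; have {}vz : e^-1 < `|v - z0|.
  exact: lt_le_trans vz (lerB_dist _ _).
rewrite normfV invf_plt ?posrE//.
by apply: lt_trans vz; rewrite invr_gt0.
Qed.

Definition chart_mx (z0 : C) : 'M[C]_2 := \matrix_(i, j)
  if i == 0 then (j == 1)%:R else if j == 0 then 1 else - z0.

Lemma det_chart_mx z0 : \det (chart_mx z0) != 0.
Proof. by rewrite det_mx22 !mxE /= mul0r sub0r mulr1 oppr_eq0 oner_eq0. Qed.

Lemma mob_chart_mx z0 (p : sphere) : p <> Some z0 ->
  mob (chart_mx z0) p = Some (chart_at z0 p).
Proof.
rewrite /mob /mob_x /mob_y !mxE /= !mul0r !mul1r !add0r /point.
case: p => [z|_] /=; last by rewrite mulr0 addr0 oner_eq0 mul0r.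
rewrite mulr1 subr_eq0 mul1r => zz0.
by case: eqVneq => // E; case: zz0; rewrite E.
Qed.

(** The coordinate 1/(z - z0) is a Moebius transformation, so it preserves
    cross ratios. *)
Lemma cross_ratio_chart_at z0 (a b c q : sphere) :
  a <> Some z0 -> b <> Some z0 -> c <> Some z0 -> q <> Some z0 ->
  let w := chart_at z0 in
  cross_ratio a b c q = (w q - w a) * (w c - w b) / ((w q - w b) * (w c - w a)).
Proof.
move=> a0 b0 c0 q0 /=.
rewrite -(cross_ratio_mob _ _ _ _ (det_chart_mx z0)) !mob_chart_mx//.
by rewrite /cross_ratio /bracket /= !mulr1 !mul1r.
Qed.

(** The point 1 + sum |p| is farther from the origin than every p in the list. *)
Lemma ex_avoid (s : seq sphere) : exists z0, forall p, p \in s -> p <> Some z0.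
Proof.
pose z0 : C := 1 + \sum_(p <- s) `|hom_x (p : option C)|.
exists z0 => p ps pE.
pose S : C := \sum_(p <- s) `|hom_x (p : option C)|.
have S0 : 0 <= S by apply: sumr_ge0.
have : `|hom_x (p : option C)| <= S.
  by rewrite /S (big_rem p)//= lerDl; apply: sumr_ge0.
rewrite pE /= ger0_norm; last exact: addr_ge0.
by rewrite gerDr ler10.
Qed.

(** Near t, the four points stay away from a z0 that they avoid at t, and there
    the coordinate 1/(z - z0) turns the cross ratio into a quotient of
    polynomials in finite quantities. *)
Lemma cross_ratio_continuous (T : topologicalType)
    (fa fb fc fq : T -> sphere) (t : T) :
  {for t, continuous fa} -> {for t, continuous fb} -> {for t, continuous fc} ->
  {for t, continuous fq} -> fq t <> fb t -> fc t <> fa t ->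
  {for t, continuous (fun x => cross_ratio (fa x) (fb x) (fc x) (fq x) : C)}.
Proof.
move=> ca cb cc cq qb ca'.
have [z0 z0P] := ex_avoid [:: fa t; fb t; fc t; fq t].
have [a0 b0 c0 q0] : [/\ fa t <> Some z0, fb t <> Some z0, fc t <> Some z0 &
    fq t <> Some z0] by split; apply: z0P; rewrite !inE eqxx ?orbT.
pose w := chart_at z0.
have winj p p' : p <> Some z0 -> p' <> Some z0 -> p <> p' -> w p - w p' != 0.
  move=> p0 p'0; rewrite subr_eq0; move=> pp'; apply/eqP => ww; apply: pp'.
  by apply: (mob_inj (det_chart_mx z0)); rewrite !mob_chart_mx// -/w ww.
have wc (f : T -> sphere) : {for t, continuous f} -> f t <> Some z0 ->
    {for t, continuous (fun x => w (f x))}.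
  by move=> cf f0; apply: continuous_comp => //; exact: chart_at_continuous.
have near0 (f : T -> sphere) : {for t, continuous f} -> f t <> Some z0 ->
    \forall x \near t, f x <> Some z0.
  by move=> cf f0; exact: cf (near_neq_some f0).
pose g x : C := (w (fq x) - w (fa x)) * (w (fc x) - w (fb x)) /
  ((w (fq x) - w (fb x)) * (w (fc x) - w (fa x))).
have gc : {for t, continuous g}.
  apply: continuousM.
    by apply: continuousM; apply: continuousB; exact: wc.
  apply: continuousV; first by rewrite mulf_neq0// winj.
  by apply: continuousM; apply: continuousB; exact: wc.
rewrite /continuous_at /prop_for (cross_ratio_chart_at a0 b0 c0 q0).
apply: cvg_trans gc.
apply: near_eq_cvg; near=> x.
by rewrite (@cross_ratio_chart_at z0) //; near: x; exact: near0.
Unshelve. all: by end_near. Qed.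

End SphereTopology.

(** * Action of the symmetric group on residues *)

Lemma coxeter_adjacent n (i j : 'I_n.+4) : j = i.+1 :> nat ->
  exists k, tperm i j = coxeter k.
Proof.
move=> ji; have hi : (i < n.+3)%N by have := ltn_ord j; lia.
exists (Ordinal hi); rewrite /coxeter; congr tperm; apply: val_inj;
  by rewrite /= inordK //; lia.
Qed.

(** The transpositions of adjacent labels generate: conjugating (i h) by
    (h h+1) gives (i h+1), and transpositions generate all permutations. *)
Lemma coxeter_ind n (P : 'S_n.+4 -> Prop) :
  P 1%g -> (forall a b, P a -> P b -> P (a * b)%g) ->
  (forall j, P (coxeter j)) -> forall sigma, P sigma.
Proof.
move=> P1 PM Pc.
have Padj (i j : 'I_n.+4) : j = i.+1 :> nat -> P (tperm i j).
  by move=> /coxeter_adjacent[k ->].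
have Plt k : forall i j : 'I_n.+4, (j = i + k.+1 :> nat)%N -> P (tperm i j).
  elim: k => [|k IH] i j ji; first by apply: Padj; lia.
  have hn : (i + k.+1 < n.+4)%N by have := ltn_ord j; lia.
  pose h := Ordinal hn.
  have -> : tperm i j = (tperm i h ^ tperm h j)%g.
    by rewrite tpermJ tpermL tpermD// -val_eqE /=; lia.
  have Ph : P (tperm i h) by exact: IH.
  have Phj : P (tperm h j) by apply: Padj => /=; lia.
  by rewrite conjgE tpermV; apply: (PM) => //; exact: (PM).
have Pt i j : P (tperm i j).
  have [ij|ji|ij] := ltngtP i j.
  - by apply: (Plt (j - i).-1); lia.
  - by rewrite tpermC; apply: (Plt (i - j).-1); lia.
  - by rewrite (val_inj ij) tperm1.
move=> sigma; have [ts -> _] := prod_tpermP sigma.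
by elim/big_ind: _.
Qed.

Section ResidueExtension.
Variables (V : pzRingType) (n : nat).

(** The s residues from the first s - 1: the last row says that the last
    residue is minus the sum of the others. *)
Definition ext_mx : 'M[V]_(n.+4, n.+3) :=
  \matrix_(a, j) if a == ord_max then -1 else (a == j :> nat)%:R.

Definition widen_label (j : 'I_n.+3) : 'I_n.+4 := widen_ord (leqnSn n.+3) j.

Lemma widen_label_neq_max j : (widen_label j == ord_max) = false.
Proof. by rewrite -val_eqE /= ltn_eqF. Qed.

Lemma ext_mx_widen i j : ext_mx (widen_label i) j = (i == j)%:R.
Proof. by rewrite mxE widen_label_neq_max. Qed.

Lemma ext_mx_max j : ext_mx ord_max j = -1.
Proof. by rewrite mxE eqxx. Qed.

Lemma widen_labelP a : a = ord_max \/ exists i, a = widen_label i.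
Proof.
have [->|am] := eqVneq a ord_max; [by left|right].
have ha : (a < n.+3)%N by move: am; rewrite -val_eqE /=; have := ltn_ord a; lia.
by exists (Ordinal ha); exact: val_inj.
Qed.

Lemma ext_mx_sum j : \sum_a ext_mx a j = 0.
Proof.
rewrite big_ord_recr /= ext_mx_max (eq_bigr (fun i => (i == j)%:R)); last first.
  by move=> i _; exact: ext_mx_widen.
by rewrite (bigD1 j)//= eqxx big1 ?addr0 ?subrr// => i /negbTE ->.
Qed.

Lemma ext_mxE (v : 'I_n.+4 -> V) a : \sum_b v b = 0 ->
  \sum_j ext_mx a j * v (widen_label j) = v a.
Proof.
case: (widen_labelP a) => [->|[i ->]] v0.
  under eq_bigr do rewrite ext_mx_max mulN1r.
  by apply/eqP; move: v0; rewrite big_ord_recr sumrN eqr_oppLR -addr_eq0 => ->.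
rewrite (bigD1 i)//= big1 ?addr0 => [|j ji]; rewrite ext_mx_widen.
  by rewrite eqxx mul1r.
by rewrite eq_sym (negbTE ji) mul0r.
Qed.
End ResidueExtension.

Section ResidueAction.
Variable n : nat.

(** The matrix A_sigma: extend to s residues, permute, forget the last one. *)
Definition res_mx (sigma : 'S_n.+4) : 'M[int]_n.+3 :=
  \matrix_(i, j) ext_mx int n ((sigma^-1)%g (widen_label i)) j.

Lemma perm_sum0 (V : nmodType) (v : 'I_n.+4 -> V) (sigma : 'S_n.+4) :
  \sum_a v (sigma a) = \sum_a v a.
Proof. by rewrite [RHS](reindex_inj (@perm_inj _ sigma)). Qed.

(** Permuted columns of ext_mx still sum to 0, so the entry forgotten by the
    inner factor is restored by the outer one (ext_mxE). *)
Lemma res_mxM sigma tau :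
  res_mx (tau * sigma)%g = res_mx sigma *m res_mx tau.
Proof.
apply/matrixP => i k; rewrite [LHS]mxE [RHS]mxE invMg permM.
have := @ext_mxE int n (fun a => ext_mx int n ((tau^-1)%g a) k)
  ((sigma^-1)%g (widen_label i)).
rewrite (perm_sum0 (fun a => ext_mx int n a k)) ext_mx_sum => /(_ erefl) <-.
by apply: eq_bigr => j _; rewrite [res_mx sigma _ _]mxE [res_mx tau _ _]mxE.
Qed.

Lemma res_mx1 : res_mx 1 = 1%:M.
Proof. by apply/matrixP => i j; rewrite mxE invg1 perm1 ext_mx_widen mxE. Qed.

Lemma res_mx_unit sigma : res_mx sigma \in unitmx.
Proof.
have : res_mx sigma *m res_mx sigma^-1 = 1%:M by rewrite -res_mxM mulVg res_mx1.
by case/mulmx1_unit.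
Qed.

Lemma res_mx_coxeter j : res_mx (coxeter j) = coxeter_A j.
Proof.
apply/matrixP => i k; rewrite mxE tpermV /coxeter_A.
case: ifPn => jn.
  have -> : tperm (inord j) (inord j.+1) (widen_label i) =
            widen_label (tperm (inord j) (inord j.+1) i).
    have wj (h : nat) : (h < n.+3)%N ->
        inord h = widen_label (inord h : 'I_n.+3) :> 'I_n.+4.
      by move=> hn; apply: val_inj; rewrite /= !inordK//; lia.
    rewrite !wj; try lia.
    case: (tpermP (inord j) _ i) => [->|->|ij ij1]; rewrite ?tpermL ?tpermR//.
    by rewrite tpermD//; apply/eqP => /(congr1 val) /= E; [case: ij|case: ij1];
      exact: val_inj.
  by rewrite ext_mx_widen !mxE.
have jE : j = ord_max by apply: val_inj => /=; have := ltn_ord j; lia.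
rewrite [RHS]mxE jE.
have -> : inord (@ord_max n.+2).+1 = ord_max :> 'I_n.+4.
  by apply: val_inj; rewrite /= inordK.
have -> : inord (@ord_max n.+2) = widen_label (@ord_max n.+2) :> 'I_n.+4.
  by apply: val_inj; rewrite /= inordK.
have [->|im] := eqVneq i ord_max; first by rewrite tpermL ext_mx_max.
rewrite tpermD ?ext_mx_widen//; last by rewrite eq_sym widen_label_neq_max.
by apply: contraNneq im => /(congr1 val) /= iE; apply/eqP/val_inj.
Qed.
End ResidueAction.

Section Residues.
Variables (R : realType) (n : nat).
Local Notation C := (R[i]^o).
Implicit Types (r : 'cV[C]_n.+3) (sigma : 'S_n.+4).

Definition residues r (a : 'I_n.+4) : C := \sum_j ext_mx C n a j * r j 0.

Lemma residues_widen r i : residues r (widen_label i) = r i 0.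
Proof.
rewrite /residues (bigD1 i)//= big1 ?addr0 => [|j ji]; rewrite ext_mx_widen.
  by rewrite eqxx mul1r.
by rewrite eq_sym (negbTE ji) mul0r.
Qed.

Lemma residues_max r : residues r ord_max = - \sum_j r j 0.
Proof.
by rewrite /residues -sumrN; apply: eq_bigr => j _; rewrite ext_mx_max mulN1r.
Qed.

Lemma residues_sum0 r : \sum_a residues r a = 0.
Proof.
rewrite big_ord_recr /= residues_max; apply/eqP; rewrite subr_eq0; apply/eqP.
by apply: eq_bigr => j _; exact: residues_widen.
Qed.

Lemma residues_restrict (v : 'I_n.+4 -> C) a :
  \sum_b v b = 0 -> residues (\col_i v (widen_label i)) a = v a.
Proof.
by move=> v0; rewrite -(ext_mxE a v0); apply: eq_bigr => j _; rewrite mxE.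
Qed.

Lemma res_mx_act sigma r :
  zmatrix R (res_mx sigma) *m r = \col_i residues r ((sigma^-1)%g (widen_label i)).
Proof.
apply/colP => i; rewrite !mxE; apply: eq_bigr => j _; congr (_ * _).
by rewrite !mxE; case: ifP => _; rewrite ?rmorphN ?rmorph1 ?rmorph_nat.
Qed.

Lemma residues_act sigma r a :
  residues (zmatrix R (res_mx sigma) *m r) a = residues r ((sigma^-1)%g a).
Proof.
rewrite res_mx_act.
apply: (residues_restrict (v := fun a => residues r ((sigma^-1)%g a))).
by rewrite (perm_sum0 (residues r)) residues_sum0.
Qed.

(** The two conditions defining Aset say that all s residues, including the last
    one, are nonzero; in this form the symmetric group clearly preserves them. *)
Lemma Aset_residuesP r : Aset r <-> forall a, residues r a != 0.
Proof.
split=> [[r0 rn0] a|rn0].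
  by have [->|[i ->]] := widen_labelP a;
    rewrite ?residues_widen// residues_max oppr_eq0.
by split=> [|i]; rewrite -?residues_widen// -oppr_eq0 -residues_max.
Qed.

Lemma Aset_act sigma r : Aset r -> Aset (zmatrix R (res_mx sigma) *m r).
Proof.
by move=> /Aset_residuesP rn0; apply/Aset_residuesP => a; rewrite residues_act.
Qed.

End Residues.

(** * Normalization of the poles and action on them *)

Section Poles.
Variables (R : realType) (n : nat).
Local Notation C := (R[i]^o).
Implicit Types (z : 'rV[C]_n.+1) (p : 'I_n.+4 -> option C) (sigma : 'S_n.+4).

(** The poles 0, oo, 1, p_4, .., p_s of a normalized form. *)
Definition std_poles z (a : 'I_n.+4) : option C :=
  match nat_of_ord a with
  | 0 => Some 0 | 1 => None | 2 => Some 1 | k.+3 => Some (z 0 (inord k))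
  end.

(** The label of the i-th pole that is not among the first three. *)
Definition far_label (i : 'I_n.+1) : 'I_n.+4 := rshift 3 i.

Definition cross_ratios p : 'rV[C]_n.+1 :=
  \row_i cross_ratio (p (inord 0)) (p (inord 1)) (p (inord 2)) (p (far_label i)).

Lemma std_poles0 z : std_poles z (inord 0) = Some 0.
Proof. by rewrite /std_poles inordK. Qed.

Lemma std_poles1 z : std_poles z (inord 1) = None.
Proof. by rewrite /std_poles inordK. Qed.

Lemma std_poles2 z : std_poles z (inord 2) = Some 1.
Proof. by rewrite /std_poles inordK. Qed.

Lemma std_poles_far z i : std_poles z (far_label i) = Some (z 0 i).
Proof. by rewrite /std_poles /= inord_val. Qed.

Lemma labelP (P : 'I_n.+4 -> Prop) :
  P (inord 0) -> P (inord 1) -> P (inord 2) -> (forall i, P (far_label i)) ->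
  forall a, P a.
Proof.
move=> P0 P1 P2 Pf [[|[|[|k]]] ka].
- by rewrite (_ : Ordinal ka = inord 0)//; apply: val_inj; rewrite /= inordK.
- by rewrite (_ : Ordinal ka = inord 1)//; apply: val_inj; rewrite /= inordK.
- by rewrite (_ : Ordinal ka = inord 2)//; apply: val_inj; rewrite /= inordK.
- rewrite (_ : Ordinal ka = far_label (Ordinal (ka : (k < n.+1)%N)))//.
  exact: val_inj.
Qed.

Lemma far_label_neq i : [/\ inord 0 != far_label i, inord 1 != far_label i &
  inord 2 != far_label i].
Proof. by split; rewrite -val_eqE /= inordK. Qed.

Lemma far_label_inj : injective far_label.
Proof. exact: (@rshift_inj 3 n.+1). Qed.

(** The conditions defining Pset say that the normalized poles are distinct. *)
Lemma std_poles_injP z : Pset z <-> injective (std_poles z).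
Proof.
split=> [[z01 zi]|zi].
  have z0 i : z 0 i <> 0 by apply/eqP; case: (z01 i).
  have z1 i : z 0 i <> 1 by apply/eqP; case: (z01 i).
  have C01 : (0 : C) <> 1 by apply/eqP; rewrite eq_sym oner_eq0.
  elim/labelP => [|||i]; elim/labelP => [|||j];
    rewrite ?std_poles0 ?std_poles1 ?std_poles2 ?std_poles_far // => E;
    try discriminate E;
    move/Some_inj: E => E.
  - by case: (C01 E).
  - by case: (z0 j (esym E)).
  - by case: (C01 (esym E)).
  - by case: (z1 j (esym E)).
  - by case: (z0 i E).
  - by case: (z1 i E).
  - by rewrite (zi i j E).
have [f0 f1 f2] := all_and3 far_label_neq.
split=> [i|i j E]; last first.
  by apply: far_label_inj; apply: zi; rewrite !std_poles_far E.
split; apply/eqP => zE.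
  by move/eqP: (f0 i); apply; apply: zi; rewrite std_poles0 std_poles_far zE.
by move/eqP: (f2 i); apply; apply: zi; rewrite std_poles2 std_poles_far zE.
Qed.

Lemma cross_ratios_std z : cross_ratios (std_poles z) = z.
Proof.
apply/rowP => i; rewrite mxE std_poles0 std_poles1 std_poles2 std_poles_far.
by rewrite /cross_ratio /bracket /=; field.
Qed.

Lemma first_labels_neq : [/\ inord 0 != inord 1 :> 'I_n.+4,
  inord 0 != inord 2 :> 'I_n.+4 & inord 1 != inord 2 :> 'I_n.+4].
Proof. by split; rewrite -val_eqE /= !inordK. Qed.

(** Normalizing the poles is a Moebius transformation.  Dividing the matrix by
    a square root of its determinant puts it in SL(2,C). *)
Lemma std_cross_ratios p : injective p ->
  exists2 M : 'M[C]_2, \det M = 1 &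
    forall a, std_poles (cross_ratios p) a = mob M (p a).
Proof.
move=> pi; have [/eqP n01 /eqP n02 /eqP n12] := first_labels_neq.
have ab : p (inord 0) != p (inord 1) by apply/eqP => /pi.
have ac : p (inord 0) != p (inord 2) by apply/eqP => /pi.
have bc : p (inord 1) != p (inord 2) by apply/eqP => /pi.
pose N := norm_mx (p (inord 0)) (p (inord 1)) (p (inord 2)).
have N0 : \det N != 0 by exact: det_norm_mx.
pose k := (sqrtc (\det N))^-1 : C.
have k2 : k ^+ 2 * \det N = 1 by rewrite exprVn sqr_sqrtc mulVf.
have k0 : k != 0 by rewrite invr_eq0 sqrtc_eq0.
exists (k *: N); first by rewrite detZ.
move=> a; rewrite mobZ//; elim/labelP: a => [|||i].
- by rewrite std_poles0 mob_norm_mx// cross_ratio0.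
- by rewrite std_poles1 mob_norm_mx_inf.
- by rewrite std_poles2 mob_norm_mx ?cross_ratio1// eq_sym.
- rewrite std_poles_far mob_norm_mx// ?mxE//.
  by apply/eqP => /pi /eqP; rewrite eq_sym; have [_ /negP + _] := far_label_neq i.
Qed.

Lemma cross_ratios_mob M p :
  \det M != 0 -> cross_ratios (mob M \o p) = cross_ratios p.
Proof. by move=> M0; apply/rowP => i; rewrite !mxE /= cross_ratio_mob. Qed.

Lemma eq_cross_ratios p p' : p =1 p' -> cross_ratios p = cross_ratios p'.
Proof. by move=> pp'; apply/rowP => i; rewrite !mxE !pp'. Qed.

Lemma Pset_cross_ratios p : injective p -> Pset (cross_ratios p).
Proof.
move=> pi; apply/std_poles_injP => a b; have [M M1 E] := std_cross_ratios pi.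
rewrite !E => /mob_inj-/(_ _)/pi; apply.
by rewrite M1 oner_eq0.
Qed.

End Poles.

Section Representation.
Variables (R : realType) (n : nat).
Local Notation C := (R[i]^o).
Implicit Types (sigma tau : 'S_n.+4).

Lemma std_poles_perm_inj sigma (z : @Pset R n) :
  injective (fun a => std_poles (\val z) ((sigma^-1)%g a)).
Proof.
by move=> a b /(proj1 (std_poles_injP _) (set_valP z)) /perm_inj.
Qed.

(** The map f_sigma: permute the normalized poles, then normalize again. *)
Definition pole_act sigma (z : @Pset R n) : @Pset R n :=
  SigSub (mem_set (Pset_cross_ratios (@std_poles_perm_inj sigma z))).

Lemma val_pole_act sigma z :
  \val (pole_act sigma z) =
  cross_ratios (fun a => std_poles (\val z) ((sigma^-1)%g a)).
Proof. by []. Qed.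

Lemma pole_act1 : pole_act 1 = id.
Proof.
apply/funext => z; apply: val_inj; rewrite val_pole_act -[RHS]cross_ratios_std.
by apply: eq_cross_ratios => a; rewrite invg1 perm1.
Qed.

(** The normalization made after tau is a Moebius transformation, which does
    not affect the cross ratios taken after sigma. *)
Lemma pole_actM sigma tau :
  pole_act (tau * sigma)%g = pole_act sigma \o pole_act tau.
Proof.
apply/funext => z; apply: val_inj.
rewrite -[RHS]/(\val (pole_act sigma (pole_act tau z))) !val_pole_act.
have [M M1 E] := std_cross_ratios (@std_poles_perm_inj tau z).
have M0 : \det M != 0 by rewrite M1 oner_eq0.
rewrite (eq_cross_ratios (fun a => E _)) -[LHS](cross_ratios_mob _ M0).
apply: eq_cross_ratios => a /=.
by rewrite invMg permM.
Qed.

Lemma pole_act_coxeter j z :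
  \val (pole_act (coxeter j) z) = coxeter_f j (\val z).
Proof.
rewrite val_pole_act /coxeter_f tpermV.
have zP := set_valP z; move: (\val z) zP => {}z [z01 _].
have tD (a b c : nat) : (a < n.+4)%N -> (b < n.+4)%N -> (c < n.+4)%N ->
    a != c -> b != c -> tperm (inord a) (inord b) (inord c) = inord c :> 'I_n.+4.
  by move=> an bn cn ac bc; rewrite tpermD// -val_eqE /= !inordK.
have tDf (a b : nat) i : (a < 3)%N -> (b < 3)%N ->
    tperm (inord a) (inord b) (far_label i) = far_label i :> 'I_n.+4.
  move=> a3 b3; rewrite tpermD// -val_eqE /= inordK; lia.
have farE i : far_label i = inord (i + 3) :> 'I_n.+4.
  by apply: val_inj; rewrite /= inordK; have := ltn_ord i; lia.
case: j => [[|[|[|j]]] jn] /=; apply/rowP => i; rewrite !mxE /coxeter /=.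
- rewrite tpermL tpermR tD// tDf// std_poles0 std_poles1 std_poles2 std_poles_far.
  by rewrite /cross_ratio /bracket /=; field; case: (z01 i).
- rewrite tpermL tpermR tD// tDf// std_poles0 std_poles1 std_poles2 std_poles_far.
  by rewrite /cross_ratio /bracket /=; field; rewrite subr_eq0;
    case: (z01 i) => _ ->.
- rewrite tpermL !tD//.
  have -> : inord 3 = far_label ord0 :> 'I_n.+4 by rewrite farE.
  rewrite std_poles0 std_poles1 std_poles_far; have [z00 _] := z01 ord0.
  have [->|i0] := eqVneq i ord0.
    by rewrite tpermR std_poles2 /cross_ratio /bracket /=; field.
  rewrite tpermD ?std_poles_far; first by rewrite /cross_ratio /bracket /=; field.
    by rewrite -val_eqE /= inordK.
  by rewrite (inj_eq (@far_label_inj n)) eq_sym.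
- have j3 : (j.+3 < n.+4)%N by lia.
  rewrite (tD _ _ 0)// (tD _ _ 1)// (tD _ _ 2)// -farE.
  rewrite std_poles0 std_poles1 std_poles2.
  have [k ->] : exists k,
      tperm (inord j.+3) (inord j.+4) (far_label i) = far_label k.
    have kE (m : nat) : (m < n.+1)%N ->
        inord m.+3 = far_label (inord m) :> 'I_n.+4.
      by move=> mn; rewrite farE inordK// addn3.
    rewrite !kE; try lia.
    by case: tpermP => _; eexists.
  rewrite std_poles_far /= addKn inord_val.
  by rewrite /cross_ratio /bracket /=; field.
Qed.

(** Homogeneous coordinates of the normalized poles as polynomials in
    p_4, .., p_s. *)
Definition pole_poly_x (a : 'I_n.+4) : mpoly.mpoly n.+1 C :=
  match nat_of_ord a with
  | 0 => 0 | 1 => 1 | 2 => 1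
  | k.+3 => mpoly.mpolyX C (mpoly.mnm1 (inord k : 'I_n.+1))
  end.

Definition pole_poly_y (a : 'I_n.+4) : mpoly.mpoly n.+1 C :=
  if nat_of_ord a is 1 then 0 else 1.

Definition poly_bracket a b :=
  pole_poly_x a * pole_poly_y b - pole_poly_y a * pole_poly_x b.

Lemma meval_bracket (z : 'rV[C]_n.+1) a b :
  mpoly.meval (fun k => z 0 k) (poly_bracket a b) =
  bracket (std_poles z a) (std_poles z b).
Proof.
rewrite /poly_bracket /pole_poly_x /pole_poly_y /std_poles /bracket.
rewrite mpoly.mevalB !mpoly.mevalM; congr (_ * _ - _ * _);
  by case: (nat_of_ord _) => [|[|[|k]]] /=;
    rewrite ?mpoly.meval0 ?mpoly.meval1 ?mpoly.mevalXU.
Qed.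

Lemma meval_bracketM (z : 'rV[C]_n.+1) a b c d :
  mpoly.meval (fun k => z 0 k) (poly_bracket a b * poly_bracket c d) =
  bracket (std_poles z a) (std_poles z b) *
  bracket (std_poles z c) (std_poles z d).
Proof. by rewrite mpoly.mevalM !meval_bracket. Qed.

(** The coordinates of f_sigma are cross ratios of normalized poles, whose
    numerator and denominator are products of brackets; the denominator does not
    vanish because the poles are distinct. *)
Lemma pole_act_rational sigma : rational_map (pole_act sigma).
Proof.
move=> i; pose l k := (sigma^-1)%g (inord k : 'I_n.+4).
pose q := (sigma^-1)%g (far_label i).
exists (poly_bracket q (l 0) * poly_bracket (l 2) (l 1)),
       (poly_bracket q (l 1) * poly_bracket (l 2) (l 0)).
move=> z; rewrite (meval_bracketM (\val z) q (l 1) (l 2) (l 0)).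
rewrite (meval_bracketM (\val z) q (l 0) (l 2) (l 1)) val_pole_act mxE.
split=> //.
have zi := @std_poles_perm_inj sigma z.
have [/eqP n01 /eqP n02 /eqP n12] := @first_labels_neq n.
have [_ /eqP n1 _] := far_label_neq i.
by rewrite mulf_neq0// bracket_eq0; apply/eqP => /zi /esym.
Qed.

Lemma pole_act_birational sigma : birational (pole_act sigma).
Proof.
split; first exact: pole_act_rational.
exists (pole_act sigma^-1); split; first exact: pole_act_rational.
- by move=> z; rewrite -[LHS]/((_ \o _) z) -pole_actM mulgV pole_act1.
- by move=> z; rewrite -[LHS]/((_ \o _) z) -pole_actM mulVg pole_act1.
Qed.
End Representation.

(** * Existence and uniqueness of the representation *)

Section Uniqueness.
Variables (R : realType) (n : nat).

Definition normal_rep : rep_data R n := (@res_mx n, @pole_act R n).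

Lemma coxeter_rep_normal_rep : coxeter_rep R n normal_rep.
Proof.
split=> /=.
- exact: res_mx_unit.
- exact: pole_act_birational.
- exact: res_mx1.
- exact: pole_act1.
- exact: res_mxM.
- exact: pole_actM.
- by move=> sigma r; exact/Aset_act/set_valP.
- exact: res_mx_coxeter.
- exact: pole_act_coxeter.
Qed.

Lemma coxeter_rep_unique rho rho' :
  coxeter_rep R n rho -> coxeter_rep R n rho' -> rho = rho'.
Proof.
move=> r r'.
have E sigma : rho.1 sigma = rho'.1 sigma /\ rho.2 sigma = rho'.2 sigma.
  elim/coxeter_ind: sigma => [|a b [a1 a2] [b1 b2]|j].
  - by rewrite !rep_A1// !rep_f1.
  - by rewrite !rep_AM// !rep_fM// a1 a2 b1 b2.
  - split; first by rewrite !rep_coxeter_A.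
    by apply/funext => z; apply: val_inj; rewrite /= !rep_coxeter_f.
case: rho r E => A f r E; case: rho' r' E => A' f' r' E.
by congr pair; apply/funext => sigma; case: (E sigma).
Qed.
End Uniqueness.

(** * Quotients, matrices and continuity *)

Section QuotientMaps.
Variables (T : topologicalType) (E : T -> T -> Prop).

Lemma quotient_map_continuous : continuous (quotient_map E).
Proof. exact: pi_continuous. Qed.

Lemma quotient_map_surj q : exists x, q = quotient_map E x.
Proof.
exists (generic_quotient.repr q).
by rewrite /quotient_map generic_quotient.reprK.
Qed.

Lemma quotient_map_eq x y : clos_refl_sym_trans T E x y <->
  quotient_map E x = quotient_map E y.
Proof.
split=> xy; first by apply/(@generic_quotient.eqmodP _ (gen_equiv E))/asboolP.
exact/asboolP/(@generic_quotient.eqmodP _ (gen_equiv E)).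
Qed.

(** Universal property of the quotient by the generated equivalence. *)
Lemma quotient_lift (Z : topologicalType) (f : T -> Z) :
  continuous f -> (forall x y, E x y -> f x = f y) ->
  exists2 g : quotient_space E -> Z, continuous g &
    forall x, g (quotient_map E x) = f x.
Proof.
move=> cf fE; have fE' x y : clos_refl_sym_trans T E x y -> f x = f y.
  by elim=> [a b|a|a b _ ->|a b c _ -> _ ->] //; exact: fE.
have gE x : f (generic_quotient.repr (quotient_map E x)) = f x.
  by apply/fE'/quotient_map_eq; rewrite /quotient_map generic_quotient.reprK.
exists (f \o generic_quotient.repr) => //.
by apply/quotient_continuous; rewrite (_ : _ \o _ = f)//; exact/funext.
Qed.
End QuotientMaps.

Lemma pair_continuous (T U V : topologicalType) (f : T -> U) (g : T -> V) :
  continuous f -> continuous g -> continuous (fun x => (f x, g x)).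
Proof. by move=> cf cg x; apply: cvg_pair; [exact: cf|exact: cg]. Qed.

Section MatrixContinuity.
Variables (T U : topologicalType) (m k : nat).

Lemma mx_continuous (f : T -> 'M[U]_(m, k)) :
  (forall i j, continuous (fun x => f x i j)) -> continuous f.
Proof.
move=> cf x A [P xP PA].
have : \forall y \near x, forall ij : 'I_m * 'I_k, P ij.1 ij.2 (f y ij.1 ij.2).
  by apply: filter_forall => -[i j]; exact: (cf i j x _ (xP i j)).
by apply: filterS => y Py; apply: PA => i j; exact: (Py (i, j)).
Qed.

Lemma mx_entry_continuous i j : continuous (fun A : 'M[U]_(m, k) => A i j).
Proof.
move=> A V AV; exists (fun i' j' => if (i' == i) && (j' == j) then V else setT).
  by move=> i' j'; case: ifPn => [/andP[/eqP-> /eqP->]//|_]; exact: filterT.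
by move=> B /(_ i j); rewrite !eqxx.
Qed.
Lemma set_entry_continuous (A : set 'M[U]_(m, k)) i j :
  continuous (fun x : A => \val x i j).
Proof.
move=> x; apply: (@continuous_comp _ _ _ (fun x : A => \val x)
                                          (fun B : 'M[U]_(m, k) => B i j)).
  exact: initial_continuous.
exact: mx_entry_continuous.
Qed.
End MatrixContinuity.

(** * The correspondence between forms and residue data *)

Section FormOfResidues.
Variable R : realType.
Local Notation C := (R[i]^o).
Variable s : nat.
Local Notation marked := (marked R s).

Lemma complex_closed (p : {poly C}) : size p != 1%N -> exists x, root p x.
Proof. by move=> sp; have /closed_rootP : size (p : {poly R[i]}) != 1%N by []. Qed.

Definition residue (x : marked) (i : 'I_s) : C := \val x.1 0 i.
Definition pole (x : marked) (i : 'I_s) : option C := \val x.2 0 i.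

Lemma residue_neq0 x i : residue x i != 0.
Proof. by have [r0 _] := set_valP x.1; exact: r0. Qed.

Lemma residue_sum_eq0 x : \sum_i residue x i = 0.
Proof. by have [_ r0] := set_valP x.1; exact: r0. Qed.

Lemma pole_inj x : injective (pole x).
Proof. exact: (set_valP x.2). Qed.

Definition marked_form (x : marked) := residue_form (residue x) (pole x).

Lemma simple_residue_marked_form x i :
  simple_residue (marked_form x) (pole x i) (residue x i).
Proof.
have := simple_residue_residue_form complex_closed (pole x) (pole x i)
  (residue_sum_eq0 x).
rewrite (bigD1 i)//= eqxx mulr1 big1 ?addr0// => j ji.
by rewrite (inj_eq (@pole_inj x)) (negbTE ji) mulr0.
Qed.

Lemma simple_residue_marked_form0 x q : (forall i, pole x i <> q) ->
  simple_residue (marked_form x) q (0 : C).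
Proof.
move=> xq; have := simple_residue_residue_form complex_closed (pole x) q
  (residue_sum_eq0 x).
rewrite big1// => i _; case: eqVneq => [/xq//|_]; exact: mulr0.
Qed.

Lemma residue_data_marked_form x : residue_data (marked_form x) x.
Proof.
split=> [q|i]; last exact: simple_residue_marked_form.
have [[i iq]|nq] := pselect (exists i, pole x i = q).
  split=> [_|_]; first by exists i.
  by rewrite -iq; apply/(is_poleP (simple_residue_marked_form x i))/residue_neq0.
split=> [|[i iq]]; last by case: nq; exists i.
have /simple_residue_marked_form0 x0 : forall i, pole x i <> q.
  by move=> i iq; apply: nq; exists i.
by move=> /(is_poleP x0); rewrite eqxx.
Qed.

(** Outside the marked poles the form is regular, so its residue vanishes;
    hence the residue data prescribe the residue at every point of the sphere. *)
Lemma residue_data_form h x : residue_data h x -> h = marked_form x.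
Proof.
move=> [poles res].
have /choice[rho rhoP] : forall q : option C, exists r : C,
    (forall i, pole x i = q -> r = residue x i) /\
    ((forall i, pole x i <> q) -> r = 0).
  move=> q.
  have [[i iq]|nq] := pselect (exists i, pole x i = q).
    exists (residue x i); split=> [j jq|/(_ i)//].
    by rewrite (@pole_inj x i j)// iq.
  by exists 0; split=> // i iq; case: nq; exists i.
apply: (eq_residues complex_closed (rho := rho)) => q; have [rho1 rho0] := rhoP q.
  have [[i iq]|nq] := pselect (exists i, pole x i = q).
    by rewrite (rho1 i iq) -iq; exact: res.
  rewrite rho0; last by move=> i iq; apply: nq; exists i.
  have [v hv] : exists v, value0 (germ h q) v.
    by apply: contrapT => /(poles q)[i iq]; apply: nq; exists i.
  by have := value0M (value0_poly 'X) hv; rewrite hornerX mul0r.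
have [[i iq]|nq] := pselect (exists i, pole x i = q).
  by rewrite (rho1 i iq) -iq; exact: simple_residue_marked_form.
have nq' i : pole x i <> q by move=> iq; apply: nq; exists i.
by rewrite rho0//; exact: simple_residue_marked_form0.
Qed.

(** Both markings enumerate the poles of h without repetition, and the residue
    at a pole is unique. *)
Lemma residue_data_perm h (x y : marked) : residue_data h x -> residue_data h y ->
  @perm_rel R s x y.
Proof.
move=> [polex resx] [poley resy].
have /choice[f fP] i : exists j, pole x j = pole y i.
  by apply/polex/poley; exists i.
have fi : injective f.
  by move=> i j fij; apply: (@pole_inj y); rewrite -!fP fij.
exists (perm fi); split; apply/rowP => i; rewrite mxE permE; last first.
  exact/esym/fP.
have := resx (f i); rewrite -[\val x.2 0 (f i)]/(pole x (f i)) fP.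
by move=> /value0_uniq -/(_ _ (resy i)) ->.
Qed.

Lemma marked_form_Omega1 x : @Omega1 R s (marked_form x).
Proof.
exists (\val x.2); have [poles res] := residue_data_marked_form x.
split=> //; first exact: set_valP.
by move=> i; split; [apply/poles; exists i|exists (\val x.1 0 i)].
Qed.

(** The form with given residue data, a point of Omega1_space. *)
Definition omega (x : marked) : Omega1_space R s :=
  SigSub (mem_set (marked_form_Omega1 x)) : @Omega1 R s.

Lemma omega_surj h : exists x, h = omega x.
Proof.
have [x /residue_data_form hom_x] := residue_data_ex h.
by exists x; apply: (@val_inj _ _ (@Omega1 R s)).
Qed.

Lemma residue_class_omega x :
  residue_class (omega x) = quotient_map (@perm_rel R s) x.
Proof.
rewrite /residue_class; case: cid => y yx /=; apply/quotient_map_eq.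
exact/rst_step/(residue_data_perm yx)/residue_data_marked_form.
Qed.

(** The topology on forms is induced by residue_class, through which omega
    becomes the projection to the quotient. *)
Lemma omega_continuous : continuous omega.
Proof.
apply: continuous_comp_initial.
rewrite (_ : _ \o _ = quotient_map (@perm_rel R s)).
  exact: quotient_map_continuous.
by apply/funext => x; exact: residue_class_omega.
Qed.

Lemma pushforward_marked_form M x y : \det M = 1 ->
  residue y =1 residue x -> pole y =1 mob M \o pole x ->
  pushforward M (marked_form x) = marked_form y.
Proof.
move=> M1 rE pE; rewrite pushforward_residue_form ?residue_sum_eq0//; last first.
  exact: complex_closed.
by apply: eq_bigr => i _; rewrite rE pE.
Qed.

Lemma psl_rel_omega M x y : \det M = 1 ->
  residue y =1 residue x -> pole y =1 mob M \o pole x ->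
  @psl_rel R s (omega x) (omega y).
Proof.
by move=> M1 rE pE; exists M; split; last exact/esym/pushforward_marked_form.
Qed.

End FormOfResidues.

(** * The homeomorphism *)

Section Homeomorphism.
Variables (R : realType) (n : nat).
Local Notation C := (R[i]^o).
Local Notation marked := (marked R n.+4).
Local Notation Mspace := (@Mspace R n).
Local Notation sphere := (sphere R).

Lemma marked_of_H (m : Mspace) : @H R n.+4 (\row_a residues (\val m.1) a).
Proof.
split=> [a|].
  by rewrite mxE; exact: (proj1 (Aset_residuesP _) (set_valP m.1)).
by under eq_bigr do rewrite mxE; exact: residues_sum0.
Qed.

Lemma marked_of_Conf (m : Mspace) :
  @Conf R n.+4 (\row_a (std_poles (\val m.2) a : sphere)).
Proof.
move=> a b; rewrite !mxE; exact: (proj1 (std_poles_injP _) (set_valP m.2)).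
Qed.

(** The form represented by a point of M(-s), marked by its normalized poles. *)
Definition marked_of (m : Mspace) : marked :=
  (SigSub (mem_set (marked_of_H m)), SigSub (mem_set (@marked_of_Conf m))).

Lemma residue_marked_of m a : residue (marked_of m) a = residues (\val m.1) a.
Proof. by rewrite /residue /= mxE. Qed.

Lemma pole_marked_of m a : pole (marked_of m) a = std_poles (\val m.2) a.
Proof. by rewrite /pole /= mxE. Qed.

Lemma normalize_Aset (x : marked) : @Aset R n (\col_i residue x (widen_label i)).
Proof.
apply/Aset_residuesP => a.
rewrite (residues_restrict (v := residue x)) ?residue_sum_eq0//.
exact: residue_neq0.
Qed.

(** The point of M(-s) obtained by moving the first three poles to 0, oo, 1. *)
Definition normalize (x : marked) : Mspace :=
  (SigSub (mem_set (normalize_Aset x)),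
   SigSub (mem_set (Pset_cross_ratios (@pole_inj _ _ x)))).

Lemma normalizeK m : normalize (marked_of m) = m.
Proof.
case: m => r z; congr pair; apply: val_inj => /=.
  by apply/colP => i; rewrite mxE residue_marked_of residues_widen.
rewrite -[RHS]cross_ratios_std; apply: eq_cross_ratios => a.
exact: pole_marked_of.
Qed.

Lemma residues_normalize x a : residues (\val (normalize x).1) a = residue x a.
Proof. by rewrite /= (residues_restrict (v := residue x)) ?residue_sum_eq0. Qed.

Lemma Mspace_residue_continuous j : continuous (fun m : Mspace => \val m.1 j 0).
Proof.
move=> m; apply: (@continuous_comp _ _ _ (fun m : Mspace => m.1)
  (fun r => \val r j 0)).
  exact: cvg_fst.
exact: set_entry_continuous.
Qed.

Lemma Mspace_pole_continuous j : continuous (fun m : Mspace => \val m.2 0 j).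
Proof.
move=> m; apply: (@continuous_comp _ _ _ (fun m : Mspace => m.2)
  (fun r => \val r 0 j)).
  exact: cvg_snd.
exact: set_entry_continuous.
Qed.

Lemma residue_continuous a : continuous (fun x : marked => residue x a).
Proof.
move=> m; apply: (@continuous_comp _ _ _ (fun m : marked => m.1)
  (fun r => \val r 0 a)).
  exact: cvg_fst.
exact: set_entry_continuous.
Qed.

Lemma pole_continuous a : continuous (fun x : marked => pole x a : sphere).
Proof.
move=> m; apply: (@continuous_comp _ _ _ (fun m : marked => m.2)
  (fun r => \val r 0 a)).
  exact: cvg_snd.
exact: set_entry_continuous.
Qed.

Lemma marked_of_continuous : continuous marked_of.
Proof.
apply: (@pair_continuous _ _ _ (fun m => (marked_of m).1)
                               (fun m => (marked_of m).2)).
  apply: continuous_comp_initial; apply: mx_continuous => i a.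
  rewrite (_ : (fun _ => _) =
               fun m : Mspace => \sum_j ext_mx C n a j * \val m.1 j 0).
    apply: continuous_big => [|j _ m]; first exact: add_continuous.
    by apply: continuousM; [exact: cst_continuous|exact: Mspace_residue_continuous].
  by apply/funext => m'; rewrite /= mxE.
apply: continuous_comp_initial; apply: mx_continuous => i a.
rewrite (_ : (fun _ => _) =
             fun m : Mspace => std_poles (\val m.2) a : sphere); last first.
  by apply/funext => m; rewrite /= mxE.
elim/labelP: a => [|||k].
- under eq_fun do rewrite std_poles0; exact: cst_continuous.
- under eq_fun do rewrite std_poles1; exact: cst_continuous.
- under eq_fun do rewrite std_poles2; exact: cst_continuous.
- under eq_fun do rewrite std_poles_far.
  move=> m; apply: continuous_comp; first exact: Mspace_pole_continuous.
  exact: one_point_compactification_some_continuous.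
Qed.

Lemma normalize_continuous : continuous normalize.
Proof.
apply: (@pair_continuous _ _ _ (fun x => (normalize x).1)
                               (fun x => (normalize x).2)).
  apply: continuous_comp_initial; apply: mx_continuous => i j.
  rewrite (_ : (fun _ => _) = fun x : marked => residue x (widen_label i)).
    exact: residue_continuous.
  by apply/funext => x; rewrite /= mxE.
apply: continuous_comp_initial; apply: mx_continuous => j i.
rewrite (_ : (fun _ => _) = fun x : marked =>
  cross_ratio (pole x (inord 0)) (pole x (inord 1)) (pole x (inord 2))
    (pole x (far_label i)) : C).
  have [/eqP n01 /eqP n02 /eqP n12] := @first_labels_neq n.
  have [_ /eqP n1 _] := far_label_neq i.
  move=> x; apply: cross_ratio_continuous; try exact: pole_continuous.
  - by move=> /pole_inj/esym.
  - by move=> /pole_inj/esym.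
by apply/funext => x; rewrite /= mxE.
Qed.

(** Relabelling before or after normalizing differs by a Moebius
    transformation, invisible to cross ratios.  The inverse of sigma occurs
    because col_perm composes with sigma, while the action moves label a to
    sigma a. *)
Lemma normalize_perm x y : @perm_rel R n.+4 x y ->
  orbit_rel (normal_rep R n) (normalize x) (normalize y).
Proof.
move=> [sigma [rE pE]]; exists (sigma^-1)%g.
have yr a : residue y a = residue x (sigma a) by rewrite /residue rE mxE.
have yp a : pole y a = pole x (sigma a) by rewrite /pole pE mxE.
split.
  rewrite res_mx_act; apply/colP => i.
  by rewrite !mxE invgK residues_normalize yr.
apply: val_inj; rewrite -[RHS]/(\val (pole_act sigma^-1 (normalize x).2)).
rewrite val_pole_act /=; have [M M1 E] := std_cross_ratios (@pole_inj _ _ x).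
transitivity (cross_ratios (mob M \o (fun a => pole x (sigma a)))).
  by rewrite cross_ratios_mob ?M1 ?oner_eq0//; exact: eq_cross_ratios.
by apply: eq_cross_ratios => a /=; rewrite E invgK.
Qed.

Lemma normalize_mob M x y : \det M != 0 -> residue y =1 residue x ->
  pole y =1 mob M \o pole x -> normalize y = normalize x.
Proof.
move=> M0 rE pE; congr pair; apply: val_inj => /=.
  by apply/colP => i; rewrite !mxE rE.
by rewrite (eq_cross_ratios pE) cross_ratios_mob.
Qed.

Lemma psl_marked_of_normalize x :
  @psl_rel R n.+4 (omega x) (omega (marked_of (normalize x))).
Proof.
have [M M1 E] := std_cross_ratios (@pole_inj _ _ x).
apply: (psl_rel_omega M1) => a.
  by rewrite residue_marked_of residues_normalize.
by rewrite pole_marked_of E.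
Qed.

Lemma mob_Conf M (x : marked) : \det M != 0 ->
  @Conf R n.+4 (\row_a (mob M (pole x a) : sphere)).
Proof. by move=> M0 a b; rewrite !mxE => /(mob_inj M0)/pole_inj. Qed.

(** An equivalence of forms lifts to marked forms: mark the image by the moved
    poles, with the same residues. *)
Lemma psl_relP h h' : @psl_rel R n.+4 h h' -> exists x y M,
  [/\ h = omega x, h' = omega y, \det M = 1, residue y =1 residue x &
      pole y =1 mob M \o pole x].
Proof.
move=> [M [M1 hh']]; have [x xE] := omega_surj h.
have M0 : \det M != 0 by rewrite M1 oner_eq0.
pose y : marked := (x.1, SigSub (mem_set (@mob_Conf M x M0))).
have yx : pole y =1 mob M \o pole x by move=> a; rewrite /pole /= mxE.
exists x, y, M; split=> //.
apply: (@val_inj _ _ (@Omega1 R n.+4)); rewrite hh' xE.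
exact: pushforward_marked_form.
Qed.

(** Acting by sigma permutes the residues and the poles simultaneously, which
    leaves the sum over all labels unchanged, and then moves the poles by the
    normalizing transformation. *)
Lemma orbit_rel_marked_of m m' : orbit_rel (normal_rep R n) m m' ->
  @psl_rel R n.+4 (omega (marked_of m)) (omega (marked_of m')).
Proof.
move=> [sigma [rE zE]].
have [M M1 E] := std_cross_ratios (@std_poles_perm_inj R n sigma m.2).
exists M; split=> //; rewrite -[LHS]/(marked_form (marked_of m')).
rewrite -[X in pushforward _ X]/(marked_form (marked_of m)).
rewrite pushforward_residue_form ?residue_sum_eq0//; last exact: complex_closed.
rewrite /marked_form /residue_form (reindex_inj (@perm_inj _ sigma)).
apply: eq_bigr => a _.
rewrite !residue_marked_of !pole_marked_of /= rE residues_act permK.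
by rewrite zE val_pole_act E permK pole_marked_of.
Qed.

(** The map normalize descends in two steps, through the marked forms modulo
    relabelling and then through the forms modulo PSL(2,C); marked_of descends in
    one.  The composite on M(-s) is the identity by normalizeK, the other one
    moves a form inside its orbit by psl_marked_of_normalize. *)
Lemma homeomorphic_normal_rep :
  homeomorphic (Omega1_mod_PSL R n.+4) (Mspace_mod_S R n (normal_rep R n)).
Proof.
pose qM := quotient_map (orbit_rel (normal_rep R n)).
pose qP := quotient_map (@psl_rel R n.+4).
have [k kc kE] : exists2 k :
      residue_space R n.+4 -> Mspace_mod_S R n (normal_rep R n),
    continuous k &
    forall x, k (quotient_map (@perm_rel R n.+4) x) = qM (normalize x).
  apply: (quotient_lift (f := qM \o normalize)).
    move=> x; apply: continuous_comp; first exact: normalize_continuous.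
    exact: quotient_map_continuous.
  by move=> x y /normalize_perm xy; apply/quotient_map_eq/rst_step.
have [f fc fE] : exists2 f :
      Omega1_mod_PSL R n.+4 -> Mspace_mod_S R n (normal_rep R n),
    continuous f & forall h, f (qP h) = k (residue_class h).
  apply: (@quotient_lift _ (@psl_rel R n.+4) _
    (k \o (@residue_class R n.+4 : Omega1_space R n.+4 -> _))).
    by move=> h; apply: continuous_comp; [exact: initial_continuous|exact: kc].
  move=> h h' /psl_relP[x [y [M [-> -> M1 rE pE]]]] /=.
  by rewrite !residue_class_omega !kE (normalize_mob _ rE pE) ?M1 ?oner_eq0.
have [g gc gE] : exists2 g :
      Mspace_mod_S R n (normal_rep R n) -> Omega1_mod_PSL R n.+4,
    continuous g & forall m, g (qM m) = qP (omega (marked_of m)).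
  apply: (quotient_lift (f := qP \o @omega R n.+4 \o marked_of)).
    move=> m; apply: continuous_comp; first exact: marked_of_continuous.
    apply: continuous_comp; first exact: omega_continuous.
    exact: quotient_map_continuous.
  by move=> m m' /orbit_rel_marked_of mm'; apply/quotient_map_eq/rst_step.
exists f, g; split=> //.
  move=> q; have [h ->] := quotient_map_surj q; have [x ->] := omega_surj h.
  rewrite fE residue_class_omega kE gE; apply/quotient_map_eq/rst_sym/rst_step.
  exact: psl_marked_of_normalize.
move=> q; have [m ->] := quotient_map_surj q.
by rewrite gE fE residue_class_omega kE normalizeK.
Qed.

End Homeomorphism.

Theorem proposition4p5 (R : realType) (n : nat) :
  (exists! rho : rep_data R n, coxeter_rep R n rho) /\
  (forall rho : rep_data R n, coxeter_rep R n rho ->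
     homeomorphic (Omega1_mod_PSL R n.+4) (Mspace_mod_S R n rho)).
Proof.
have normP := @coxeter_rep_normal_rep R n; split.
  by exists (normal_rep R n); split=> // rho; exact: coxeter_rep_unique.
move=> rho /(coxeter_rep_unique normP) <-; exact: homeomorphic_normal_rep.
Qed.
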